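(* Let $m_0>1$, $p_0=m_0^{-1}$, and let $(\omega_x)_{x\in\mathbb Z^2}$ be i.i.d. geometric weights with $\mathbb P\{\omega_x\ge k\}=(1-p_0)^{k-1}$ for $k\in\mathbb N=\{1,2,\dots\}$ (so the mean is $m_0$ and the variance is $m_0(m_0-1)$). Let $\varphi^{(l)}=(\varphi^{(l)}_n)_{n\ge0}$ and $\varphi^{(r)}=(\varphi^{(r)}_n)_{n\ge0}$ be the competition interfaces of the tree of leftmost geodesics and of the tree of rightmost geodesics from $0$, respectively. Then the almost sure limits $$n^{-1}\varphi^{(l)}_n\to\xi_*^{(l)}\quad\text{and}\quad n^{-1}\varphi^{(r)}_n\to\xi_*^{(r)}$$ exist, and the angles $\theta_*^{(a)}=\tan^{-1}\big(\xi_*^{(a)}\cdot e_2/\xi_*^{(a)}\cdot e_1\big)$, $a\in\{l,r\}$, have the following distributions: for $t\in[0,\pi/2]$, $$\mathbb P\{\theta_*^{(r)}\le t\}=\frac{\sqrt{(1-p_0)\sin t}}{\sqrt{(1-p_0)\sin t}+\sqrt{\cos t}}\qquad\text{and}\qquad \mathbb P\{\theta_*^{(l)}\le t\}=\frac{\sqrt{\sin t}}{\sqrt{\sin t}+\sqrt{(1-p_0)\cos t}}.$$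
   Context: Notation: $e_1=(1,0)$, $e_2=(0,1)$. An up-right path has steps in $\{e_1,e_2\}$. For $x\le y$ coordinatewise in $\mathbb Z^2$, $G_{x,y}=\max\sum_{k=0}^{n-1}\omega_{x_k}$, the maximum over up-right paths $x_0=x,\dots,x_n=y$, $n=|y-x|_1$; maximizing paths are geodesics. Among the geodesics between two points the leftmost (rightmost) one has at each step the smallest (largest) $e_1$-coordinate. The leftmost (rightmost) geodesics from $0$ to the points $v\in\mathbb Z_+^2$ form a tree rooted at $0$ and spanning $\mathbb Z_+^2$; its competition interface $\varphi^{(l)}$ (resp. $\varphi^{(r)}$) is the up-right path on $(\tfrac12,\tfrac12)+\mathbb Z_+^2$ started at $(\tfrac12,\tfrac12)$ that separates the subtrees rooted at $e_1$ and $e_2$. Explicitly, with the convention $G_{e_i,ne_j}=-\infty$ for $i\ne j$, $n\ge0$, and $\Delta_n(k)=G_{e_2,(k,n-k)}-G_{e_1,(k,n-k)}$, for each $n\ge1$: $\varphi^{(l)}_{n-1}=(k+\tfrac12,n-k-\tfrac12)$ for the unique $0\le k<n$ with $\Delta_n(k)\ge0>\Delta_n(k+1)$, and $\varphi^{(r)}_{n-1}=(k+\tfrac12,n-k-\tfrac12)$ for the unique $0\le k<n$ with $\Delta_n(k)>0\ge\Delta_n(k+1)$. *)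

(* Defs.v *)
From HB Require Import structures.
From mathcomp Require Import all_boot all_order all_algebra.
From mathcomp Require Import finmap.
From mathcomp Require Import all_classical all_reals all_analysis.
From mathcomp Require Import zify ring lra.

Set Implicit Arguments.
Unset Strict Implicit.
Unset Printing Implicit Defensive.

Import Order.TTheory GRing.Theory Num.Theory.
Import numFieldNormedType.Exports.

Local Open Scope classical_set_scope.
Local Open Scope ring_scope.

Notation lattice := (int * int)%type.

Definition e1 : lattice := (1, 0).
Definition e2 : lattice := (0, 1).

Definition up_right : rel lattice := [rel x y | (y == x + e1) || (y == x + e2)].

(* A path [x = x_0, x_1, ..., x_n = y] is given by [x] and [s = x_1, ..., x_n]. *)
Definition up_right_path (x y : lattice) (s : seq lattice) : bool :=
  path up_right x s && (last x s == y).

Section LastPassage.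
Context {R : realType}.
Variable omega : lattice -> R.

(* The weight at the final vertex of the path is not counted. *)
Definition path_weight (x : lattice) (s : seq lattice) : R :=
  \sum_(z <- belast x s) omega z.

(* The supremum is over a finite set, hence a maximum, and equals [-oo] when
   no up-right path goes from [x] to [y]. *)
Definition passage_time (x y : lattice) : \bar R :=
  ereal_sup [set (path_weight x s)%:E | s in [set s | up_right_path x y s]].

Definition geodesic (x y : lattice) (s : seq lattice) : Prop :=
  up_right_path x y s /\ (path_weight x s)%:E = passage_time x y.

Definition leftmost_geodesic (x y : lattice) (s : seq lattice) : Prop :=
  geodesic x y s /\ forall s', geodesic x y s' ->
    forall k, (k <= size s)%N -> (nth x (x :: s) k).1 <= (nth x (x :: s') k).1.

Definition rightmost_geodesic (x y : lattice) (s : seq lattice) : Prop :=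
  geodesic x y s /\ forall s', geodesic x y s' ->
    forall k, (k <= size s)%N -> (nth x (x :: s') k).1 <= (nth x (x :: s) k).1.

End LastPassage.

(* [branch x y s] says that [s] is the branch from [x] to [y] in a tree rooted
   at [x]; the vertices of the subtree rooted at [a] are those whose branch
   from the root [0] goes through [a]. *)
Definition subtree (branch : lattice -> lattice -> seq lattice -> Prop)
    (a : lattice) : set lattice :=
  [set v | exists2 s, branch 0 v s & a \in 0 :: s].

(* The path [phi] starts at (1/2, 1/2), has steps e1 and e2, and separates the
   subtrees rooted at e2 (above and left of [phi]) and at e1 (below and right of
   [phi]): [phi n] lies on the antidiagonal [v.1 + v.2 = n + 1], on which points
   are ordered by their first coordinate. *)
Definition competition_interface {R : realType}
    (branch : lattice -> lattice -> seq lattice -> Prop)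
    (phi : nat -> R * R) : Prop :=
  [/\ phi 0%N = (2^-1, 2^-1),
      (forall n, phi n.+1 = phi n + (1, 0) \/ phi n.+1 = phi n + (0, 1)),
      (forall n v, v.1 + v.2 = n.+1%:Z -> subtree branch e2 v ->
         v.1%:~R < (phi n).1) &
      (forall n v, v.1 + v.2 = n.+1%:Z -> subtree branch e1 v ->
         (phi n).1 < v.1%:~R)].

(* Angle of a nonzero vector of the closed first quadrant, in [0, pi/2]; the
   first case is needed because [x / 0 = 0]. *)
Definition angle {R : realType} (xi : R * R) : R :=
  if xi.1 == 0 then pi / 2 else atan (xi.2 / xi.1).

Definition mutually_independent {R : realType} {d d' : measure_display}
    {T : measurableType d} {T' : measurableType d'} (P : probability T R)
    {I : choiceType} (X : I -> {RV P >-> T'}) : Prop :=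
  forall (J : {fset I}) (A : I -> set T'), (forall i, measurable (A i)) ->
    P (\bigcap_(i in [set` J]) (X i @^-1` A i)) =
    (\prod_(i <- J) P (X i @^-1` A i))%E.

(* For [k = 0], resp. [k = n], this is [+oo], resp. [-oo], as no up-right path
   goes from e1 to (0, n) or from e2 to (n, 0). *)
Definition Delta {R : realType} (omega : lattice -> R) (n k : nat) : \bar R :=
  let v : lattice := (k%:Z, n%:Z - k%:Z) in
  (passage_time omega e2 v - passage_time omega e1 v)%E.

Module InterfaceFacts.
Section Facts.
Context {R : realType}.
Variable om : lattice -> R.
Implicit Types (x y z : lattice) (s : seq lattice).

Lemma geodesicP x y s : geodesic om x y s <-> up_right_path x y s /\
  forall s', up_right_path x y s' -> path_weight om x s' <= path_weight om x s.
Proof.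
split=> -[ps H]; split => //.
  move=> s' ps'; rewrite -lee_fin H; apply: ereal_sup_ubound; by exists s'.
apply/eqP; rewrite eq_le; apply/andP; split.
  by apply: ereal_sup_ubound; exists s.
by apply: ge_ereal_sup => _ [s' ps' <-]; rewrite lee_fin H.
Qed.

(* Leftmost geodesics for [b = true], rightmost ones for [b = false]. *)
Definition extremal b x y s := geodesic om x y s /\ forall s', geodesic om x y s' ->
  forall k, (k <= size s)%N ->
  if b then (nth x (x :: s) k).1 <= (nth x (x :: s') k).1
  else (nth x (x :: s') k).1 <= (nth x (x :: s) k).1.

(* The points at distance [n] from [x], for [0 <= i <= n]. *)
Definition q x n i : lattice := (x.1 + i%:Z, x.2 + (n%:Z - i%:Z)).

Lemma q00 x : q x 0 0 = x.
Proof. by case: x => a b0; congr pair => /=; lia. Qed.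

Lemma up_rightE x y : up_right x y =
  ((y.1 == x.1 + 1) && (y.2 == x.2)) || ((y.1 == x.1) && (y.2 == x.2 + 1)).
Proof.
rewrite -[X in _ = (_ && (_ == X)) || _]addr0 -[X in _ = _ || (_ == X) && _]addr0.
by [].
Qed.

Lemma up_right_q x n k i : (i <= n.+1)%N ->
  up_right (q x n k) (q x n.+1 i) = (i == k.+1) || (i == k).
Proof. by move=> h; rewrite up_rightE /q /=; lia. Qed.

Lemma path_last x s : path up_right x s ->
  exists2 k, (k <= size s)%N & last x s = q x (size s) k.
Proof.
elim/last_ind: s => [_|s z IH]; first by exists 0%N; rewrite ?q00.
rewrite rcons_path last_rcons size_rcons => /andP[/IH[k kn ->]].
rewrite up_rightE /q /= => h.
case: z h => [c d] /= /orP[] /andP[/eqP -> /eqP ->].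
  by exists k.+1; [lia|congr pair; lia].
by exists k; [lia|congr pair; lia].
Qed.

Lemma size_path x n i s : up_right_path x (q x n i) s -> size s = n.
Proof.
move=> /andP[/path_last[k kn ->]] /eqP; rewrite /q => -[]. lia.
Qed.

Lemma weight_rcons x s z :
  path_weight om x (rcons s z) = path_weight om x s + om (last x s).
Proof. by rewrite /path_weight belast_rcons lastI -cats1 big_cat big_seq1. Qed.

Variable b : bool.

Section F.
Variable x : lattice.

(* The extremal geodesic from [x] to [q x n i]. *)
Fixpoint F n i : seq lattice :=
  if n is n'.+1 then
    let v k := path_weight om x (F n' k) + om (q x n' k) in
    let p := if i == 0 then 0%N else if i == n then n'
      else if (if b then v i <= v i.-1 else v i < v i.-1) then i.-1 else i in
    rcons (F n' p) (q x n i)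
  else [::].

Lemma FS n i : (i <= n.+1)%N -> exists k, [/\ (k <= n)%N, i == k.+1 \/ i == k,
   F n.+1 i = rcons (F n k) (q x n.+1 i) &
   forall k', (k' <= n)%N -> (i == k'.+1) || (i == k') ->
     let v k := path_weight om x (F n k) + om (q x n k) in
     v k' <= v k /\ (k' != k -> if b then (v k' = v k -> k <= k')%N else (v k' = v k -> k' <= k)%N)].
Proof.
move=> ni /=; set v := fun k => path_weight om x (F n k) + om (q x n k).
case: eqP => [->|i0].
  exists 0%N; split=> //; [by right|]. move=> k' _ /orP[]//. move=> /eqP <-; by rewrite lexx eqxx.
case: eqP => [->|iN].
  exists n; split=> //; [by left|]. move=> k' kn h; have -> : k' = n by lia.
  by rewrite lexx eqxx.
have -> : path_weight om x (F n i) + om (q x n i) = v i by [].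
have -> : path_weight om x (F n i.-1) + om (q x n i.-1) = v i.-1 by [].
have K : forall k', (i == k'.+1) || (i == k') -> k' = i.-1 \/ k' = i by lia.
case: ifP => H.
  exists i.-1; split=> //; [lia|left; lia|].
  move=> k' kn /K[->|->]; last split.
  - by rewrite lexx eqxx.
  - by case: (b) H => // /ltW.
  - move=> _; case: (b) H => [_ _|]; first lia. by move=> L E; case: (elimF eqP (lt_eqF L) E).
exists i; split=> //; [lia|by right|].
have H' : v i.-1 <= v i by case: (b) H => /negbT; rewrite -?ltNge -?leNgt // => /ltW.
move=> k' kn /K[->|->]; first split=> //.
- move=> _; case: (b) H => [/negbT|_ _]; last lia. by rewrite -ltNge => L E; case: (elimF eqP (lt_eqF L) E).
- by rewrite lexx eqxx.
Qed.

Lemma Fpath n i : (i <= n)%N -> up_right_path x (q x n i) (F n i).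
Proof.
elim: n i => [|n IH] i ni.
  have -> : i = 0%N by lia.
  by rewrite /up_right_path q00 /= eqxx.
have [k [kn ik -> _]] := FS ni.
have /andP[p /eqP l] := IH _ kn.
rewrite /up_right_path rcons_path last_rcons p l eqxx andbT /=.
by rewrite [up_right _ _]up_right_q //; apply/orP.
Qed.

Lemma Fsize n i : (i <= n)%N -> size (F n i) = n.
Proof. by move=> /Fpath/size_path. Qed.

Lemma Fmono n i k : (i < n)%N -> (k <= n)%N ->
  (nth x (x :: F n i) k).1 <= (nth x (x :: F n i.+1) k).1.
Proof.
elim: n i k => // n IH i k ni kn.
have [|p [pn ip Fi _]] := @FS n i; first lia.
have [|p' [pn' ip' Fi' _]] := @FS n i.+1; first lia.
rewrite Fi Fi' -!rcons_cons !nth_rcons /= !Fsize //.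
have [kl|] := ltnP k n.+1; last first.
  move=> h; have -> : k = n.+1 by lia. by rewrite eqxx /=; lia.
have [<-//|pp'] := eqVneq p p'.
have [e|e] : p' = p.+1 \/ p' = p.+2 by lia.

  by rewrite e; apply: IH; lia.
by rewrite e; apply: (le_trans (IH p k _ _) (IH p.+1 k _ _)); lia.
Qed.

Lemma pathS n i s : (i <= n.+1)%N -> up_right_path x (q x n.+1 i) s ->
  exists k s', [/\ (k <= n)%N, (i == k.+1) || (i == k), s = rcons s' (q x n.+1 i) &
    up_right_path x (q x n k) s'].
Proof.
move=> ni ps; move: (ps) => /size_path; case/lastP: s ps => // s z.
rewrite /up_right_path rcons_path last_rcons size_rcons => /andP[/andP[p u] /eqP zE] [sn].
have [k] := path_last p; rewrite sn => kn l.
exists k, s; split=> //; last by rewrite p l eqxx.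
  by rewrite -(@up_right_q x n) // -l -zE.
by rewrite zE.
Qed.

Lemma Fmax n i s : (i <= n)%N -> up_right_path x (q x n i) s ->
  path_weight om x s <= path_weight om x (F n i).
Proof.
elim: n i s => [|n IH] i s ni ps.
  by move/size_path : ps => /size0nil ->.
have [k [kn ik -> H]] := FS ni.
have [k' [s' [kn' ik' -> ps']]] := pathS ni ps.
have /andP[_ /eqP l'] := ps'.
have /andP[_ /eqP l] := Fpath kn.
rewrite !weight_rcons l l'.
have [+ _] := H _ kn' ik'; apply: le_trans.
by rewrite lerD2r; apply: IH.
Qed.

Lemma Fgeo n i : (i <= n)%N -> geodesic om x (q x n i) (F n i).
Proof. move=> ni; apply/geodesicP; split; [exact: Fpath|move=> s'; exact: Fmax]. Qed.

Lemma geo_prefix n k i s' : (k <= n)%N -> (i <= n.+1)%N -> (i == k.+1) || (i == k) ->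
  up_right_path x (q x n k) s' ->
  geodesic om x (q x n.+1 i) (rcons s' (q x n.+1 i)) ->
  geodesic om x (q x n k) s' /\ path_weight om x (F n.+1 i) = path_weight om x (F n k) + om (q x n k).
Proof.
move=> kn ni ik ps' /geodesicP[p0 H0].
have E : path_weight om x s' = path_weight om x (F n k).
  apply/eqP; rewrite eq_le Fmax //=.
  have /andP[p /eqP l] := Fpath kn.
  have := H0 (rcons (F n k) (q x n.+1 i)).
  rewrite !weight_rcons; have /andP[_ /eqP ->] := ps'. rewrite l lerD2r; apply.
  by rewrite /up_right_path rcons_path last_rcons p l eqxx andbT /= [up_right _ _]up_right_q.
split; first by apply/geodesicP; split=> // s2 ps2; rewrite E Fmax.
apply/eqP; rewrite eq_le; apply/andP; split.
  apply: le_trans (H0 _ (Fpath ni)) _. rewrite weight_rcons E. by have /andP[_ /eqP ->] := ps'.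
have /andP[_ /eqP l'] := ps'.
by have := Fmax ni p0; rewrite weight_rcons l' E.
Qed.

Lemma Fex n i : (i <= n)%N -> extremal b x (q x n i) (F n i).
Proof.
move=> ni; split; first exact: Fgeo.
elim: n i ni => [|n IH] i ni s gs k.
  by case: gs => /size_path/size0nil -> _; rewrite if_same.
have [p [pn ip FE H]] := FS ni.
rewrite Fsize // => kn.
have [k' [s' [kn' ik' sE ps']]] := pathS ni gs.1.
rewrite sE in gs *.
have [gs' W'] := geo_prefix kn' ni ik' ps' gs.
rewrite FE -!rcons_cons !nth_rcons /= Fsize // (size_path ps').
have [kl|_] := ltnP k n.+1; last by rewrite lexx if_same.
have /= B := IH _ kn' _ gs' k; rewrite Fsize // in B; have {}B := B kl.
have [e|ne] := eqVneq k' p; first by rewrite -e.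
have /andP[_ /eqP l] := Fpath pn.
have [_ /(_ ne)] := H _ kn' ik'.
rewrite -W' FE weight_rcons l.
case: (b) B => B /(_ erefl) le.
  apply: le_trans B; have -> : k' = p.+1 by lia.
  by apply: Fmono; lia.
apply: le_trans B _; have -> : p = k'.+1 by lia.
by apply: Fmono; lia.
Qed.

Lemma passageE n i : (i <= n)%N ->
  passage_time om x (q x n i) = (path_weight om x (F n i))%:E.
Proof. by move=> ni; have [_ ->] := Fgeo ni. Qed.

Lemma passageN n i : (n < i)%N -> passage_time om x (q x n i) = -oo%E.
Proof.
move=> ni; rewrite /passage_time (_ : [set s | _] = set0) ?image_set0 ?ereal_sup0 //.
apply/seteqP; split=> // s /= ps; have := size_path ps.
case/andP: ps => /path_last[k kn ->] /eqP [] + _ E; rewrite E in kn *. lia.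
Qed.

Lemma passageN' y : y.1 < x.1 -> passage_time om x y = -oo%E.
Proof.
move=> ni; rewrite /passage_time (_ : [set s | _] = set0) ?image_set0 ?ereal_sup0 //.
apply/seteqP; split=> // s /= /andP[/path_last[k kn ->] /eqP E].
by rewrite -E /= in ni; lia.
Qed.

End F.

Definition PD n k : bool := if b then (0 <= Delta om n k)%E else (0 < Delta om n k)%E.

(* The path [F 0 n.+1 i] starts with the step e2. *)
Definition c n i := (nth 0 (0 :: F 0 n.+1 i) 1).1 == 0.

Lemma q0E n k : ((k%:Z, n%:Z - k%:Z) : lattice) = q 0 n k.
Proof. by rewrite /q /= !add0r. Qed.

Lemma q2E n k : q 0 n.+1 k = q e2 n k.
Proof. rewrite /q /=; congr pair; lia. Qed.

Lemma q1E n k : q 0 n.+1 k.+1 = q e1 n k.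
Proof. rewrite /q /=; congr pair; lia. Qed.

Lemma up_right0 z : up_right 0 z = (z == e1) || (z == e2).
Proof. by rewrite -[e1]add0r -[e2]add0r. Qed.

Lemma path_first n i s : up_right_path 0 (q 0 n.+1 i) s ->
  exists s', (s = e1 :: s' /\ up_right_path e1 (q 0 n.+1 i) s') \/
             (s = e2 :: s' /\ up_right_path e2 (q 0 n.+1 i) s').
Proof.
move=> ps; have := size_path ps; case: s ps => // z s /andP[/andP[+ p] l] _.
rewrite up_right0 => u; exists s; case/orP: u => /eqP E; rewrite E in p l *; [left|right];
 by split=> //; apply/andP; split.
Qed.

Lemma path_cons1 y s : up_right_path e1 y s -> up_right_path 0 y (e1 :: s).
Proof.
by move=> /andP[p l]; apply/andP; split=> //; apply/andP; split.
Qed.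
Lemma path_cons2 y s : up_right_path e2 y s -> up_right_path 0 y (e2 :: s).
Proof.
by move=> /andP[p l]; apply/andP; split=> //; apply/andP; split.
Qed.

Lemma weight_cons z s : path_weight om 0 (z :: s) = om 0 + path_weight om z s.
Proof. by rewrite /path_weight /= big_cons. Qed.

Lemma PDc n i : (i <= n.+1)%N -> PD n.+1 i = c n i.
Proof.
move=> ni; rewrite /PD /Delta q0E.
have [i0|i0] := posnP i.
  rewrite i0 [passage_time om e1 _]passageN'; last by rewrite /q /=; lia.
  rewrite [passage_time om e2 _](_ : _ = (path_weight om e2 (F e2 n 0))%:E) /=; last first.
    by rewrite q2E passageE.
  rewrite leey lt0y if_same /c.
  have [s' [[E p]|[-> _]]] := path_first (Fpath 0 (leq0n n.+1)); last by [].
  have /andP[/path_last[k kn ->]] := p. by rewrite /q => /eqP[]; lia.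
have [iN|iN] := eqVneq i n.+1.
  rewrite iN [passage_time om e2 _](_ : _ = -oo%E); last by rewrite q2E passageN.
  rewrite [passage_time om e1 _](_ : _ = (path_weight om e1 (F e1 n n))%:E) /=; last first.
    by rewrite q1E passageE.
  rewrite leeNy_eq ltNge leNye if_same /c.
  have [s' [[-> _]|[E p]]] := path_first (Fpath 0 (leqnn n.+1)); first by [].
  have /andP[/path_last[k kn ->]] := p. by rewrite /q => /eqP[]; lia.
have iE : i = i.-1.+1 by lia.
have G2 : geodesic om e2 (q 0 n.+1 i) (F e2 n i) by rewrite q2E; apply: Fgeo; lia.
have G1 : geodesic om e1 (q 0 n.+1 i) (F e1 n i.-1) by rewrite iE q1E; apply: Fgeo; lia.
rewrite -G2.2 -G1.2 -EFinB lee_fin lte_fin subr_ge0 subr_gt0.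
move/geodesicP: G1 => [p1 m1]; move/geodesicP: G2 => [p2 m2].
have [/geodesicP[p0 m0] ex0] := Fex 0 ni.
rewrite /c.
have Fs := Fsize 0 ni.
have [s' [[E p]|[E p]]] := path_first p0; rewrite E in m0 ex0 Fs * => /=.
  (* e1 *)
  apply/negbTE/negP => H.
  have le12 : path_weight om e1 (F e1 n i.-1) <= path_weight om e2 (F e2 n i).
    by case: (b) H => // /ltW.
  have /= := m0 _ (path_cons2 p2). rewrite !weight_cons lerD2l => /[dup] m0' /(le_trans le12) Q.
  have E1 : path_weight om e1 s' = path_weight om e1 (F e1 n i.-1).
    by apply/eqP; rewrite eq_le Q m1.
  move: (b) H ex0 => [] H ex0; last by move: m0'; rewrite E1 leNgt H.
  have E2 : path_weight om e1 s' = path_weight om e2 (F e2 n i).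
    by apply/eqP; rewrite eq_le m0' andbT E1.
  suff /ex0/(_ 1%N isT) : geodesic om 0 (q 0 n.+1 i) (e2 :: F e2 n i) by [].
  apply/geodesicP; split; first exact: path_cons2.
  by move=> s2 /m0; rewrite !weight_cons E2.
have /= := m0 _ (path_cons1 p1); rewrite !weight_cons lerD2l => m0'.
have le := le_trans m0' (m2 _ p).
transitivity true => //.
move: (b) ex0 => [] ex0; first exact: le.
rewrite lt_neqAle le andbT; apply/eqP => E12.
have E2 : path_weight om e2 s' = path_weight om e1 (F e1 n i.-1).
  by apply/eqP; rewrite eq_le m0' andbT E12 m2.
suff /ex0/(_ 1%N isT) : geodesic om 0 (q 0 n.+1 i) (e1 :: F e1 n i.-1) by [].
apply/geodesicP; split; first exact: path_cons1.
by move=> s2 /m0; rewrite !weight_cons E2.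
Qed.

Lemma c0 n : c n 0.
Proof.
rewrite /c; have [s' [[E p]|[-> _]]] := path_first (Fpath 0 (leq0n n.+1)); last by [].
by have /andP[/path_last[k kn ->]] := p; rewrite /q => /eqP[]; lia.
Qed.

Lemma cN n : c n n.+1 = false.
Proof.
rewrite /c; have [s' [[-> _]|[E p]]] := path_first (Fpath 0 (leqnn n.+1)); first by [].
by have /andP[/path_last[k kn ->]] := p; rewrite /q => /eqP[]; lia.
Qed.

Lemma c_mono n i j : (i <= j)%N -> (j <= n.+1)%N -> c n j -> c n i.
Proof.
move=> ij; elim: j ij => [|j IH] ij jn.
  by have -> : i = 0%N by lia.
have [->//|ne] := eqVneq i j.+1.
move=> cj; apply: IH; [lia|lia|].
have := @Fmono 0 n.+1 j 1 jn isT; move: cj; rewrite /c => /eqP ->.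
have [s' [[->]|[->]]] := path_first (Fpath 0 (ltnW jn)); by [].
Qed.

Lemma c_step n i : (i <= n.+2)%N -> exists2 k, (k <= n.+1)%N /\ (i == k.+1 \/ i == k) &
  c n.+1 i = c n k.
Proof.
move=> /(@FS 0 n.+1)[k [kn ik E _]]; exists k => //; rewrite /c E.
by have := Fsize 0 kn; case: (F 0 n.+1 k).
Qed.

Lemma subtree2 n i : (i <= n.+1)%N -> subtree (extremal b) e2 (q 0 n.+1 i) <-> c n i.
Proof.
move=> ni; split.
  move=> [s [gs es] m]; have [ps _] := gs.
  have F1 := Fsize 0 ni; have S1 := size_path ps.
  have sE : (nth 0 (0 :: s) 1).1 = (nth 0 (0 :: F 0 n.+1 i) 1).1.
    have [gF eF] := Fex 0 ni.
    have := eF _ gs 1%N; rewrite F1 => /(_ isT).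
    have := es _ gF 1%N; rewrite S1 => /(_ isT).
    by case: (b) => A B; apply/eqP; rewrite eq_le A B.
  rewrite /c -sE.
  have [s' [[E p]|[-> _]]] := path_first ps; last by [].
  move: m; rewrite E !inE => /orP[//|/orP[//|]].
  case/andP: p => /=; clear -R.
  suff H : forall x s, path up_right x s -> forall z, z \in s -> x.1 <= z.1.
    by move=> p _ m; have := H _ _ p _ m.
  move=> x s; elim: s x => // y s IH x /andP[+ p] z; rewrite up_rightE inE => xy /orP[/eqP ->|]; first lia.
  move=> /(IH _ p); lia.
rewrite /c => ci; exists (F 0 n.+1 i); first exact: Fex.
move: ci; have [s' [[-> _]|[-> _]]] := path_first (Fpath 0 ni) => //.
Qed.

Lemma subtree1 n i : (i <= n.+1)%N -> subtree (extremal b) e1 (q 0 n.+1 i) <-> ~~ c n i.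
Proof.
move=> ni; split.
  move=> [s [gs es] m]; have [ps _] := gs.
  have F1 := Fsize 0 ni; have S1 := size_path ps.
  have sE : (nth 0 (0 :: s) 1).1 = (nth 0 (0 :: F 0 n.+1 i) 1).1.
    have [gF eF] := Fex 0 ni.
    have := eF _ gs 1%N; rewrite F1 => /(_ isT).
    have := es _ gF 1%N; rewrite S1 => /(_ isT).
    by case: (b) => A B; apply/eqP; rewrite eq_le A B.
  rewrite /c -sE.
  have [s' [[-> _]|[E p]]] := path_first ps; first by [].
  move: m; rewrite E !inE => /orP[//|/orP[//|]].
  case/andP: p => /=; clear -R.
  suff H : forall x s, path up_right x s -> forall z, z \in s -> x.2 <= z.2.
    by move=> p _ m; have := H _ _ p _ m.
  move=> x s; elim: s x => // y s IH x /andP[+ p] z; rewrite up_rightE inE => xy /orP[/eqP ->|]; first lia.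
  move=> /(IH _ p); lia.
rewrite /c => ci; exists (F 0 n.+1 i); first exact: Fex.
move: ci; have [s' [[-> _]|[-> _]]] := path_first (Fpath 0 ni) => //.
Qed.

Definition explicit_interface (phi : nat -> R * R) := forall n, exists k, [/\ (k < n.+1)%N,
  PD n.+1 k, ~~ PD n.+1 k.+1 & phi n = (k%:R + 2^-1, (n.+1 - k)%:R - 2^-1)].

Lemma explicit_unique phi phi' : explicit_interface phi -> explicit_interface phi' -> phi = phi'.
Proof.
move=> H H'; apply: funext => n.
have [k [kn a b1 ->]] := H n; have [k' [kn' a' b' ->]] := H' n.
rewrite !PDc // in a b1 a' b'; try lia.
suff -> : k = k' by [].
apply/eqP; rewrite eqn_leq; apply/andP; split; rewrite leqNgt; apply/negP => h.
  by move/negP: b'; apply; apply: (c_mono _ _ a); lia.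
by move/negP: b1; apply; apply: (c_mono _ _ a'); lia.
Qed.

Lemma explicit_exists : exists phi, explicit_interface phi.
Proof.
suff /choice[phi h] : forall n, exists v : R * R, exists k, [/\ (k < n.+1)%N,
  PD n.+1 k, ~~ PD n.+1 k.+1 & v = (k%:R + 2^-1, (n.+1 - k)%:R - 2^-1)] by exists phi.
move=> n.
have exN : exists k, ~~ c n k by exists n.+1; rewrite cN.
case: (ex_minnP exN) => -[|k]; first by rewrite c0.
move=> ck km; have kn : (k < n.+1)%N by apply: km; rewrite cN.
exists (k%:R + 2^-1, (n.+1 - k)%:R - 2^-1); exists k; split=> //; rewrite PDc //; last lia.
by apply/negPn/negP => /km; rewrite ltnn.
Qed.

Lemma subtree_q a v n : v.1 + v.2 = n.+1%:Z -> subtree (extremal b) a v ->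
  exists i, (i <= n.+1)%N /\ v = q 0 n.+1 i.
Proof.
move=> vn [s [[/andP[/path_last[k kn E] /eqP E'] _] _] _]; exists k.
rewrite E in E'; rewrite -E' /q /= in vn *.
have sn : size s = n.+1 by lia.
by rewrite sn in kn *.
Qed.

Lemma interfaceP phi : competition_interface (extremal b) phi <-> explicit_interface phi.
Proof.
split.
  move=> [p0 ps S2 S1] n.
  have [k [kn E]] : exists k, (k < n.+1)%N /\ phi n = (k%:R + 2^-1, (n.+1 - k)%:R - 2^-1).
    elim: n => [|n [k [kn E]]]; first by exists 0%N; rewrite p0; split=> //; rewrite ?subn0; congr pair; lra.
    have /= := ps n; rewrite E => -[] ->.
      exists k.+1; split; first lia. congr pair => /=; first by rewrite -natr1; ring.
      by rewrite subSS addr0.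
    exists k; split; first lia. congr pair => /=; first by rewrite addr0.
    by rewrite (subSn (ltnW kn)) -[(n.+1 - k).+1%:R]natr1; ring.
  exists k; split=> //; rewrite PDc //; try lia.
    apply/negPn/negP => /(subtree1 (ltnW kn)) h.
    have : (phi n).1 < (q 0 n.+1 k).1%:~R by apply: S1 h; rewrite /q /=; lia.
    by rewrite E /q /= add0r -[_%:~R]/(k%:R); lra.
  apply/negP => /(subtree2 kn) h.
  have : (q 0 n.+1 k.+1).1%:~R < (phi n).1 by apply: S2 h; rewrite /q /=; lia.
  by rewrite E /q /= add0r -[_%:~R]/(k.+1%:R) -natr1; lra.
move=> H; split.
- have [k [kn _ _ ->]] := H 0%N; have -> : k = 0%N by lia.
  by rewrite ?subn0; congr pair; lra.
- move=> n.
  have [k [kn a b1 ->]] := H n; have [k' [kn' a' b' ->]] := H n.+1.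
  rewrite !PDc // in a b1 a' b'; try lia.
  have [|k1 [kn1 ik1] ck1] := @c_step n k'; first lia.
  have [|k2 [kn2 ik2] ck2] := @c_step n k'.+1; first lia.
  rewrite ck1 in a'; rewrite ck2 in b'.
  have l1 : (k1 <= k)%N.
    rewrite leqNgt; apply/negP => h; move/negP: b1; apply; apply: (c_mono _ _ a'); lia.
  have l2 : (k < k2)%N.
    rewrite ltnNge; apply/negP => h; move/negP: b'; apply; apply: (c_mono _ _ a); lia.
  have [->|->] : k' = k.+1 \/ k' = k by lia.
    left; congr pair => /=; first by rewrite -natr1; ring.
    by rewrite subSS addr0.
  right; congr pair => /=; first by rewrite addr0.
  by rewrite (subSn (ltnW kn)) -[(n.+1 - k).+1%:R]natr1; ring.
- move=> n v vn S.
  have [k [kn a b1 ->]] := H n; rewrite !PDc // in a b1; try lia.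
  have [i [ni E]] := subtree_q vn S.
  have ik : (i <= k)%N.
    rewrite E in S; rewrite leqNgt; apply/negP => ik; move/negP: b1; apply.
    by apply: (c_mono _ _ ((subtree2 ni).1 S)); lia.
  rewrite E /q /= add0r -[_%:~R]/(i%:R).
  by move: ik; rewrite -(ler_nat R); lra.
- move=> n v vn S.
  have [k [kn a b1 ->]] := H n; rewrite !PDc // in a b1; try lia.
  have [i [ni E]] := subtree_q vn S.
  have ik : (k < i)%N.
    rewrite E in S; rewrite ltnNge; apply/negP => ik; move/negP: ((subtree1 ni).1 S); apply.
    by apply: (c_mono _ _ a); lia.
  rewrite E /q /= add0r -[_%:~R]/(i%:R).
  by move: ik; rewrite -(ler_nat R) -natr1; lra.
Qed.

End Facts.
End InterfaceFacts.

(* Both competition interfaces exist, are unique, and are given by the sign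
   changes of [Delta]. *)

Lemma leftmost_interfaceP {R : realType} (omega : lattice -> R)
    (phi : nat -> R * R) :
  competition_interface (leftmost_geodesic omega) phi <->
  forall n, exists k, [/\ (k < n.+1)%N, (0 <= Delta omega n.+1 k)%E,
    (Delta omega n.+1 k.+1 < 0)%E &
    phi n = (k%:R + 2^-1, (n.+1 - k)%:R - 2^-1)].
Proof.
have /= H := InterfaceFacts.interfaceP omega true phi; rewrite H.
by split=> h n; have [k [a b c e]] := h n; exists k; split=> //; move: c;
  rewrite /InterfaceFacts.PD -ltNge.
Qed.

Lemma rightmost_interfaceP {R : realType} (omega : lattice -> R)
    (phi : nat -> R * R) :
  competition_interface (rightmost_geodesic omega) phi <->
  forall n, exists k, [/\ (k < n.+1)%N, (0 < Delta omega n.+1 k)%E,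
    (Delta omega n.+1 k.+1 <= 0)%E &
    phi n = (k%:R + 2^-1, (n.+1 - k)%:R - 2^-1)].
Proof.
have /= H := InterfaceFacts.interfaceP omega false phi; rewrite H.
by split=> h n; have [k [a b c e]] := h n; exists k; split=> //; move: c;
  rewrite /InterfaceFacts.PD -leNgt.
Qed.

Lemma leftmost_interface_exists {R : realType} (omega : lattice -> R) :
  exists! phi : nat -> R * R, competition_interface (leftmost_geodesic omega) phi.
Proof.
have /= H := InterfaceFacts.interfaceP omega true.
have [phi h] := InterfaceFacts.explicit_exists omega true.
exists phi; split=> [|phi' /H]; first exact/H.
exact: InterfaceFacts.explicit_unique.
Qed.

Lemma rightmost_interface_exists {R : realType} (omega : lattice -> R) :
  exists! phi : nat -> R * R, competition_interface (rightmost_geodesic omega) phi.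
Proof.
have /= H := InterfaceFacts.interfaceP omega false.
have [phi h] := InterfaceFacts.explicit_exists omega false.
exists phi; split=> [|phi' /H]; first exact/H.
exact: InterfaceFacts.explicit_unique.
Qed.

(* Main.v *)
Require Import Defs.
From HB Require Import structures.
From mathcomp Require Import all_boot all_order all_algebra.
From mathcomp Require Import finmap.
From mathcomp Require Import all_classical all_reals all_analysis.
From mathcomp Require Import zify ring lra.

Set Implicit Arguments.
Unset Strict Implicit.
Unset Printing Implicit Defensive.

Import Order.TTheory GRing.Theory Num.Theory.
Import numFieldNormedType.Exports.

Local Open Scope classical_set_scope.
Local Open Scope ring_scope.

(** Write q = 1 - p0 and subtract 1 from every weight: this shifts all the
passage times between two points by the same amount. A point v lies in the
subtree of e2 according to the sign of G_(e2,v) - G_(e1,v), and the two trees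
differ only by the treatment of ties: v is in the subtree of e2 when
c + G_(e1,v) <= G_(e2,v), with c = 0 for leftmost and c = 1 for rightmost
geodesics.

_A stationary field._ For q < a < 1 and b = q / a, put independent geometric
increments of parameter a on the bottom edges of the quadrant, of parameter b
on its left edges, and geometric variables of parameter q in its cells, and
propagate them by I(i,j+1) = eta + (I - J)^+ and J(i+1,j) = eta + (J - I)^+.
These are the increments of a function, [height], which is a Busemann function
for the weights V = min(I, J). One step of the propagation is, up to
reversal, an involution of the data which preserves a^I b^J (ab)^eta; hence
so is the propagation through a box ([reversalK], [config_prob_reversal]). So
the weights V are again independent and geometric of parameter q
([prob_fieldV]), and any event about the original weights can be examined
together with such a field.

_Comparison._ Let B(x,v) be the height of v minus that of x. The defect
B(e1,v) - G_(e1,v) is a first-passage distance, for nonnegative edge costs,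
the increments minus the weight of the vertex which the edge leaves, such that every vertex has a free outgoing edge. If no
vertex of the column of v up to the height of v is reached at no cost from e1,
then the free path from e1 passes above v, every path from e2 to v crosses
it, and G_(e2,v) - G_(e1,v) <= I(0,0) - J(0,0) ([crossing]). If v is far away
and strictly below the characteristic direction of a, a free visit is
exponentially unlikely, because G is also bounded by the field of a smaller
parameter, whose mean is strictly smaller in that direction
([characteristic_gap], [prob_exact]). Hence the probability that e2 leads by c
at some far point of such a sector is at most that of J(0,0) + c <= I(0,0),
up to a small error ([prob_far_lead]).

_The limit._ Let y_n be the share of the vertical coordinate in the n-th point
of the interface. When the direction of the sector approaches the
characteristic one, this bound reads: y_n <= f for some n >= N has probability at most F(f) + eps, for the claimed
distribution function F. Transposing the lattice exchanges e1 with e2 and c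
with 1 - c, and bounds the probability that y_n >= f for some n >= N by
1 - F(f) + eps. Since y_n <= f infinitely often or y_n >= f infinitely often,
both bounds are attained in the limit and the two events overlap on a null
set. Letting f range over the rationals, y_n converges almost surely, and its
limit has the distribution function F ([cvg_of_tail_bounds]). *)

(** * Last-passage times and stationary fields *)

Section LastPassageNat.
Local Open Scope nat_scope.
Implicit Types (V : nat -> nat -> nat).

Fixpoint lpp V i : nat -> nat :=
  if i is i'.+1 then
    fix col j := if j is j'.+1
      then maxn (lpp V i' j'.+1 + V i' j'.+1) (col j' + V i'.+1 j')
      else lpp V i' 0 + V i' 0
  else fun j => \sum_(0 <= j' < j) V 0 j'.

(** The same weights seen from e1 and from e2. *)
Definition shift1 V i j := V i.+1 j.
Definition shift2 V i j := V i j.+1.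

Lemma lpp_right V i j : lpp V i j + V i j <= lpp V i.+1 j.
Proof. by case: j => [|j] //=; rewrite leq_maxl. Qed.

Lemma lpp_up V i j : lpp V i j + V i j <= lpp V i j.+1.
Proof. by case: i => [|i] /=; rewrite ?leq_maxr // big_nat_recr. Qed.

Lemma lpp_le V (b : nat -> nat -> nat) :
  (forall i j, b i j + V i j <= b i.+1 j) ->
  (forall i j, b i j + V i j <= b i j.+1) ->
  forall i j, lpp V i j + b 0 0 <= b i j.
Proof.
move=> b1 b2; elim=> [|i IHi]; elim=> [|j IHj] /=.
- by rewrite big_geq.
- by rewrite big_nat_recr //=; move: (b2 0 j) IHj => /=; lia.
- by move: (b1 i 0) (IHi 0); lia.
- by move: IHj (IHi j.+1) (b1 i j.+1) (b2 i.+1 j) => /=; lia.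
Qed.

Lemma eq_lpp V V' k l :
  (forall i j, i <= k -> j <= l -> V i j = V' i j) -> lpp V k l = lpp V' k l.
Proof.
elim: k l => [|k IHk]; elim=> [|l IHl] VV' /=.
- by rewrite !big_geq.
- by apply: eq_big_nat => j jl; apply: VV'; lia.
- by rewrite IHk ?VV' // => i j ? ?; apply: VV'; lia.
- rewrite IHk; last by move=> i j ? ?; apply: VV'; lia.
  rewrite -!/(lpp _ k.+1 l) IHl; last by move=> i j ? ?; apply: VV'; lia.
  by rewrite !VV'.
Qed.

Lemma lpp_succ V k l : lpp (fun i j => (V i j).+1) k l = lpp V k l + (k + l).
Proof.
elim: k l => [|k IHk]; elim=> [|l IHl] /=.
- by rewrite !big_geq.
- by move: IHl => /=; rewrite !big_nat_recr //= => ->; lia.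
- by rewrite IHk; lia.
- by rewrite IHk; move: IHl => /= ->; lia.
Qed.

Lemma lpp_tr V k l : lpp (fun i j => V j i) k l = lpp V l k.
Proof.
elim: k l => [|k IHk]; elim=> [|l IHl].
- by rewrite /= !big_geq.
- by move: IHl => /=; rewrite big_nat_recr //= => ->; case: l.
- by move: (IHk 0) => /=; rewrite big_nat_recr //= => ->.
- by rewrite /= IHk -/(lpp V l.+1 k) maxnC; move: IHl => /= ->.
Qed.

End LastPassageNat.

Section StationaryField.
Local Open Scope nat_scope.
Variables (I0 J0 : nat -> nat) (eta : nat -> nat -> nat).

(** The increments are propagated column by column: the horizontal increments
   of a column are determined by its bottom increment and by the vertical
   increments on its left. *)
Fixpoint columnI (x : nat) (Jc etac : nat -> nat) j :=
  if j is j'.+1 then etac j' + (columnI x Jc etac j' - Jc j') else x.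

Fixpoint incJ i : nat -> nat :=
  if i is i'.+1 then
    fun j => eta i' j + (incJ i' j - columnI (I0 i') (incJ i') (eta i') j)
  else J0.

Definition incI i := columnI (I0 i) (incJ i) (eta i).

Definition bulk i j := minn (incI i j) (incJ i j).

Definition height i j :=
  \sum_(0 <= i' < i) incI i' 0 + \sum_(0 <= j' < j) incJ i j'.

Lemma incIS i j : incI i j.+1 = eta i j + (incI i j - incJ i j).
Proof. by []. Qed.

Lemma incJS i j : incJ i.+1 j = eta i j + (incJ i j - incI i j).
Proof. by []. Qed.

Lemma heightSr i j : height i j.+1 = height i j + incJ i j.
Proof. by rewrite /height big_nat_recr //= addnA. Qed.

Lemma heightSl i j : height i.+1 j = height i j + incI i j.
Proof.
elim: j => [|j IH]; first by rewrite /height !(big_geq (leqnn 0)) big_nat_recr //= !addn0.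
by rewrite !heightSr IH incIS incJS; lia.
Qed.

Lemma height10 : height 1 0 = incI 0 0.
Proof. by rewrite /height big_nat1 big_geq ?addn0. Qed.

Lemma height01 : height 0 1 = incJ 0 0.
Proof. by rewrite /height big_nat1 big_geq. Qed.

Let g1 := lpp (shift1 bulk).
Let g2 := lpp (shift2 bulk).

Lemma lpp1_height k l : g1 k l + incI 0 0 <= height k.+1 l.
Proof.
rewrite -height10; apply: (lpp_le (b := fun i j => height i.+1 j)) => i j.
  by rewrite (heightSl i.+1) leq_add2l geq_minl.
by rewrite heightSr leq_add2l geq_minr.
Qed.

Lemma lpp2_height k l : g2 k l + incJ 0 0 <= height k l.+1.
Proof.
rewrite -height01; apply: (lpp_le (b := fun i j => height i j.+1)) => i j.
  by rewrite heightSl leq_add2l geq_minl.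
by rewrite (heightSr i j.+1) leq_add2l geq_minr.
Qed.

(** Call a point exact if the passage time from e1 attains the difference of
    heights. The weight of a vertex is the minimum of its two increments, so
    that exactness passes from a point to at least one of its two
    successors. *)
Lemma exact_climbs k j : g1 k j + incI 0 0 = height k.+1 j ->
  g1 k.+1 j + incI 0 0 < height k.+2 j -> g1 k j.+1 + incI 0 0 = height k.+1 j.+1.
Proof.
have := lpp_right (shift1 bulk) k j; have := lpp_up (shift1 bulk) k j.
have := lpp1_height k j.+1.
rewrite -/g1 /shift1 /bulk (heightSl k.+1) heightSr; lia.
Qed.

(** The planarity argument, by induction on the end point (k+1, l+1). If the
    end point itself is exact, the bound on paths from e2 suffices. Otherwise a
    geodesic from e2 arrives from the left or from below. From below the
    hypothesis is inherited. From the left, either it is inherited too, or the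
    column on the left contains an exact point, and exactness then climbs along
    that column up to the height of the end point. *)
Lemma crossing k l : (forall j, j <= l -> g1 k j + incI 0 0 < height k.+1 j) ->
  g2 k.+1 l + incJ 0 0 <= g1 k l.+1 + incI 0 0.
Proof.
move: {2}(k + l) (leqnn (k + l)) => n; elim: n k l => [|n IH] k l nkl below.
  have k0 : k = 0 by lia.
  by have := below 0 isT; rewrite k0 height10 /g1 /= big_geq //; lia.
have [exact|inexact] := eqVneq (g1 k l.+1 + incI 0 0) (height k.+1 l.+1).
  by rewrite exact lpp2_height.
case: k nkl below inexact => [|k] nkl below _.
  by have := below 0 isT; rewrite height10 /g1 /= big_geq //; lia.
have left : g2 k.+1 l + incJ 0 0 <= g1 k l.+1 + incI 0 0.
  have [allbelow|] := pselect (forall j, j <= l -> g1 k j + incI 0 0 < height k.+1 j).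
    by apply: IH => //; lia.
  move=> /existsNP[j /not_implyP[jl /negP]]; rewrite -leqNgt => hj.
  suff E : forall d, j + d <= l.+1 -> g1 k (j + d) + incI 0 0 = height k.+1 (j + d).
    have := E (l.+1 - j); rewrite subnKC; last lia.
    by move=> ->; [exact: lpp2_height|].
  elim=> [|d IHd] jd; first by rewrite addn0; have := lpp1_height k j; lia.
  by rewrite addnS; apply: exact_climbs; [apply: IHd|apply: below]; lia.
have := lpp_right (shift1 bulk) k l.+1; rewrite -/g1 /shift1 => right1.
have -> : g2 k.+2 l = maxn (g2 k.+1 l + bulk k.+1 l.+1)
   (if l is l'.+1 then g2 k.+2 l' + bulk k.+2 l else 0).
  by rewrite /g2; case: (l) => //; rewrite maxn0.
suff : (if l is l'.+1 then g2 k.+2 l' + bulk k.+2 l else 0) + incJ 0 0 <=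
   g1 k.+1 l.+1 + incI 0 0 by lia.
have := lpp_up (shift1 bulk) k.+1 l; rewrite -/g1 /shift1 => up1.
case: l nkl below left right1 up1 => [|l] nkl below left right1 up1; first lia.
have : g2 k.+2 l + incJ 0 0 <= g1 k.+1 l.+1 + incI 0 0; last lia.
by apply: IH => [|j jl]; [lia|apply: below; lia].
Qed.

Lemma incI_balance i m :
  incI i 0 + \sum_(0 <= j < m) eta i j = incI i m + \sum_(0 <= j < m) bulk i j.
Proof.
elim: m => [|m IH]; first by rewrite !big_geq.
by rewrite !big_nat_recr //= incIS addnA IH /bulk; lia.
Qed.

Lemma incJ_balance n j :
  incJ 0 j + \sum_(0 <= i < n) eta i j = incJ n j + \sum_(0 <= i < n) bulk i j.
Proof.
elim: n => [|n IH]; first by rewrite !big_geq.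
by rewrite !big_nat_recr //= addnA IH -/(incI n j) /bulk; lia.
Qed.

End StationaryField.

Section StationaryFieldComparison.
Local Open Scope nat_scope.

Lemma eq_incI_incJ n m I0 J0 eta I0' J0' eta' :
  (forall i, i < n -> I0 i = I0' i) -> (forall j, j < m -> J0 j = J0' j) ->
  (forall i j, i < n -> j < m -> eta i j = eta' i j) ->
  (forall i j, i < n -> j <= m -> incI I0 J0 eta i j = incI I0' J0' eta' i j) /\
  (forall i j, i <= n -> j < m -> incJ I0 J0 eta i j = incJ I0' J0' eta' i j).
Proof.
move=> eI eJ ee.
have HI i : i < n -> (forall j, j < m -> incJ I0 J0 eta i j = incJ I0' J0' eta' i j) ->
    forall j, j <= m -> incI I0 J0 eta i j = incI I0' J0' eta' i j.
  move=> ni H; elim=> [|j IH] jm; first exact: eI.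
  by rewrite !incIS ee // H // IH //; lia.
have HJ i j : i <= n -> j < m -> incJ I0 J0 eta i j = incJ I0' J0' eta' i j.
  elim: i j => [|i IH] j ni jm; first exact: eJ.
  rewrite !incJS ee // IH ?HI //; try lia.
  by move=> j' jm'; apply: IH; lia.
by split=> // i j ni jm; apply: HI => // j' jm'; apply: HJ; lia.
Qed.

(** The one-step map (I, J, eta) to (I', J', min(I, J)) is inverted by the
    same formulas: I = min(I, J) + (I' - J')^+, and likewise for J and eta. So
    the field read from the opposite corner solves the same recursion. *)
Lemma reverse_incI_incJ n m I0 J0 eta I0' J0' eta' :
  (forall i, i < n -> I0' i = incI I0 J0 eta (n - i.+1) m) ->
  (forall j, j < m -> J0' j = incJ I0 J0 eta n (m - j.+1)) ->
  (forall i j, i < n -> j < m ->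
     eta' i j = bulk I0 J0 eta (n - i.+1) (m - j.+1)) ->
  (forall i j, i < n -> j <= m ->
     incI I0' J0' eta' i j = incI I0 J0 eta (n - i.+1) (m - j)) /\
  (forall i j, i <= n -> j < m ->
     incJ I0' J0' eta' i j = incJ I0 J0 eta (n - i) (m - j.+1)).
Proof.
move=> eI eJ ee.
have HI i : i < n -> (forall j, j < m ->
      incJ I0' J0' eta' i j = incJ I0 J0 eta (n - i) (m - j.+1)) ->
    forall j, j <= m -> incI I0' J0' eta' i j = incI I0 J0 eta (n - i.+1) (m - j).
  move=> ni H; elim=> [|j IH] jm; first by rewrite subn0; exact: eI.
  rewrite incIS ee // H // IH ?(ltnW jm) //.
  have -> : n - i = (n - i.+1).+1 by lia.
  have -> : m - j = (m - j.+1).+1 by lia.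
  by rewrite incIS incJS /bulk; lia.
have HJ i j : i <= n -> j < m ->
    incJ I0' J0' eta' i j = incJ I0 J0 eta (n - i) (m - j.+1).
  elim: i j => [|i IH] j ni jm; first by rewrite subn0; exact: eJ.
  rewrite incJS ee // IH ?(HI i) ?(ltnW ni) ?(ltnW jm) //; last first.
    by move=> j' jm'; apply: IH; lia.
  have -> : n - i = (n - i.+1).+1 by lia.
  have -> : m - j = (m - j.+1).+1 by lia.
  by rewrite incIS incJS /bulk; lia.
by split=> // i j ni jm; apply: HI => // j' jm'; apply: HJ; lia.
Qed.

End StationaryFieldComparison.

(** * Families of independent geometric variables *)

Section ExtendedSums.
Context {R : realType}.

Lemma le_esum_set (T : choiceType) (A B : set T) (a : T -> \bar R) :
  (forall x, 0 <= a x)%E -> A `<=` B ->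
  (\esum_(x in A) a x <= \esum_(x in B) a x)%E.
Proof.
move=> a0 AB; rewrite esum_mkcond [leRHS]esum_mkcond; apply: le_esum => x _.
case: ifPn => [|_]; first by rewrite inE => /AB xB; rewrite mem_set.
by case: ifPn.
Qed.

Lemma esumZl (T : choiceType) (A : set T) (a : T -> \bar R) (c : R) :
  (forall x, 0 <= a x)%E -> 0 <= c ->
  (\esum_(x in A) (c%:E * a x) = c%:E * \esum_(x in A) a x)%E.
Proof.
move=> a0; rewrite le_eqVlt => /orP[/eqP <-|c0].
  by rewrite mul0e esum1// => x _; rewrite mul0e.
have half d (b : T -> \bar R) : (forall x, 0 <= b x)%E -> 0 < d ->
    (\esum_(x in A) (d%:E * b x) <= d%:E * \esum_(x in A) b x)%E.
  move=> b0 d0; apply: ge_ereal_sup => _ [F [finF FA] <-].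
  rewrite fsbig_finite//= -ge0_sume_distrr//.
  rewrite lee_pmul2l// -fsbig_finite//; apply: ereal_sup_ubound.
  by exists F.
apply/eqP; rewrite eq_le half//=.
rewrite -[leRHS]mul1e -(divff (lt0r_neq0 c0)) EFinM -muleA.
rewrite lee_pmul2l//; apply: le_trans (half c^-1 _ _ _); rewrite ?invr_gt0//; last first.
  by move=> x; apply: mule_ge0 => //; rewrite lee_fin ltW.
by apply: le_esum => x _; rewrite muleA -EFinM mulVf ?lt0r_neq0// mul1e.
Qed.

Lemma esum_ffun_ord n (p : 'I_n -> nat -> R) (s : 'I_n -> R) :
  (forall i k, 0 <= p i k) ->
  (forall i, \esum_(k in [set: nat]) (p i k)%:E = (s i)%:E) ->
  \esum_(f in [set: {ffun 'I_n -> nat}]) (\prod_i p i (f i))%:E =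
  (\prod_i s i)%:E.
Proof.
elim: n p s => [|n IH] p s p0 ps.
  rewrite big_ord0 (_ : [set: _] = [set [ffun=> 0%N]]); last first.
    by apply/seteqP; split=> // f _ /=; apply/ffunP => -[].
  by rewrite esum_set1 big_ord0.
pose glue (z : nat * {ffun 'I_n -> nat}) : {ffun 'I_n.+1 -> nat} :=
  [ffun i => oapp z.2 z.1 (unlift ord0 i)].
have glue0 z : glue z ord0 = z.1 by rewrite ffunE unlift_none.
have glueS z i : glue z (lift ord0 i) = z.2 i by rewrite ffunE liftK.
have bij_glue : set_bij ([set: nat] `*`` fun=> [set: {ffun 'I_n -> nat}]) [set: _] glue.
  split=> //.
    move=> [x f] [y g] _ _ E; congr pair.
      by have := congr1 (fun h : {ffun 'I_n.+1 -> nat} => h ord0) E; rewrite !glue0.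
    apply/ffunP => i.
    by have := congr1 (fun h : {ffun 'I_n.+1 -> nat} => h (lift ord0 i)) E; rewrite !glueS.
  move=> f _; exists (f ord0, [ffun i => f (lift ord0 i)]) => //.
  apply/ffunP => i; case: (unliftP ord0 i) => [j|] ->; first by rewrite glueS ffunE.
  by rewrite glue0.
rewrite (reindex_esum _ _ _ _ bij_glue).
under eq_esum do rewrite big_ord_recl glue0.
have -> : \esum_(z in [set: nat] `*`` fun=> [set: {ffun 'I_n -> nat}])
    (p ord0 z.1 * \prod_(i < n) p (lift ord0 i) (glue z (lift ord0 i)))%:E =
  \esum_(z in [set: nat] `*`` fun=> [set: {ffun 'I_n -> nat}])
    (p ord0 z.1 * \prod_(i < n) p (lift ord0 i) (z.2 i))%:E.
  by apply: eq_esum => z _; under eq_bigr do rewrite glueS.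
rewrite -(esum_esum (a := fun x (f : {ffun 'I_n -> nat}) =>
   (p ord0 x * \prod_(i < n) p (lift ord0 i) (f i))%:E)); last first.
  by move=> x f _ _; rewrite lee_fin mulr_ge0 ?prodr_ge0.
pose S := \prod_(i < n) s (lift ord0 i).
have s0 i : 0 <= s i.
  by rewrite -lee_fin -ps esum_ge0// => k _; rewrite lee_fin.
have step x : \esum_(f in [set: {ffun 'I_n -> nat}])
    (p ord0 x * \prod_(i < n) p (lift ord0 i) (f i))%:E = (S%:E * (p ord0 x)%:E)%E.
  under eq_esum do rewrite EFinM.
  rewrite (esumZl _ (a := fun f : {ffun 'I_n -> nat} =>
    (\prod_(i < n) p (lift ord0 i) (f i))%:E))//; last first.
    by move=> f; rewrite lee_fin prodr_ge0.
  by rewrite (IH (fun i => p (lift ord0 i)) (fun i => s (lift ord0 i)))// muleC.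
under eq_esum do rewrite step.
rewrite esumZl; last 2 first.
- by move=> x; rewrite lee_fin.
- by apply: prodr_ge0.
by rewrite ps -EFinM big_ord_recl mulrC.
Qed.

(** The finite Fubini identity from which all the independence statements are
    derived. *)
Lemma esum_ffun (K : finType) (p : K -> nat -> R) (s : K -> R) :
  (forall i k, 0 <= p i k) ->
  (forall i, \esum_(k in [set: nat]) (p i k)%:E = (s i)%:E) ->
  \esum_(f in [set: {ffun K -> nat}]) (\prod_i p i (f i))%:E =
  (\prod_i s i)%:E.
Proof.
move=> p0 ps.
pose e (g : {ffun 'I_#|K| -> nat}) : {ffun K -> nat} := [ffun i => g (enum_rank i)].
have bij_e : set_bij [set: _] [set: _] e.
  split=> //.
    move=> g h _ _ E; apply/ffunP => i.
    have := congr1 (fun f : {ffun K -> nat} => f (enum_val i)) E.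
    by rewrite !ffunE enum_valK.
  move=> f _; exists [ffun i => f (enum_val i)] => //.
  by apply/ffunP => i; rewrite !ffunE enum_rankK.
rewrite (reindex_esum _ _ _ _ bij_e).
have E (F : K -> R) : \prod_i F i = \prod_(i < #|K|) F (enum_val i).
  by rewrite (reindex (@enum_val K K)) //; exact/onW_bij/enum_val_bij.
under eq_esum => f _.
  rewrite E; under eq_bigr do rewrite ffunE enum_valK; over.
by rewrite (E s); apply: (esum_ffun_ord (p := fun i => p (enum_val i))).
Qed.

Lemma esum_geometric (c z : R) : 0 <= c -> 0 <= z < 1 ->
  \esum_(k in [set: nat]) (c * z ^+ k)%:E = (c / (1 - z))%:E.
Proof.
move=> c0 /andP[z0 z1].
rewrite -nneseries_esumT; last by move=> n; rewrite lee_fin mulr_ge0 ?exprn_ge0.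
apply/cvg_lim => //; rewrite (_ : (fun n => _) = EFin \o series (geometric c z)).
  by apply: cvg_EFin; [exact: nearW|apply: cvg_geometric_series; rewrite ger0_norm].
by apply/funext => n; rewrite /= /series /= sumEFin.
Qed.

End ExtendedSums.

Section GeometricConfigurations.
Context {R : realType}.

Definition geometric_pmf (r : R) (k : nat) : R := (1 - r) * r ^+ k.

Section Law.
Variables (K : finType).
Implicit Types (r : K -> R) (A B : set {ffun K -> nat}).

(** The law of independent geometric variables indexed by a finite type; their
   values form a countable set, so that probabilities are plain sums. *)
Definition config_pmf r (f : {ffun K -> nat}) : R :=
  \prod_i geometric_pmf (r i) (f i).

Definition config_prob r A : \bar R := \esum_(f in A) (config_pmf r f)%:E.

Definition subunit r := forall i, 0 < r i < 1.

Lemma geometric_pmf_ge0 (a : R) k : 0 < a < 1 -> 0 <= geometric_pmf a k.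
Proof.
by move=> /andP[a0 a1]; rewrite mulr_ge0 ?exprn_ge0 ?subr_ge0// ltW.
Qed.

Lemma config_pmf_ge0 r f : subunit r -> 0 <= config_pmf r f.
Proof. by move=> hr; apply: prodr_ge0 => i _; apply: geometric_pmf_ge0. Qed.

Lemma le_config_prob r A B : subunit r -> A `<=` B ->
  (config_prob r A <= config_prob r B)%E.
Proof.
by move=> hr AB; apply: le_esum_set => // f; rewrite lee_fin config_pmf_ge0.
Qed.

Lemma config_probU r A B : subunit r ->
  (config_prob r (A `|` B) <= config_prob r A + config_prob r B)%E.
Proof.
move=> hr; have p0 f : (0 <= (config_pmf r f)%:E)%E by rewrite lee_fin config_pmf_ge0.
rewrite /config_prob esum_mkcond (esum_mkcond A) (esum_mkcond B) -esumD.
- apply: le_esum => f _; case: ifPn => [|_]; last by apply: adde_ge0; case: ifPn.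
  rewrite inE => -[] fA; rewrite (mem_set fA) ?leeDl ?leeDr//; by case: ifPn.
- by move=> f _; case: ifPn.
- by move=> f _; case: ifPn.
Qed.

Lemma config_prob_bigcup r (I : finType) (P : pred I)
    (A : I -> set {ffun K -> nat}) : subunit r ->
  (config_prob r [set f | exists2 i, P i & A i f] <=
   \sum_(i | P i) config_prob r (A i))%E.
Proof.
move=> hr.
suff H (s : seq I) : (config_prob r [set f | exists2 i, (i \in s) && P i & A i f] <=
    \sum_(i <- s | P i) config_prob r (A i))%E.
  apply: le_trans (H (index_enum I)); apply: le_config_prob => // f [i Pi Af].
  by exists i; rewrite ?mem_index_enum.
elim: s => [|i s IH].
  rewrite big_nil (_ : [set f | _] = set0) /config_prob ?esum_set0//.
  by apply/seteqP; split=> // f [i].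
rewrite big_cons; case: ifPn => Pi.
  apply: le_trans (leeD2l _ IH); apply: le_trans (config_probU _ _ hr).
  apply: le_config_prob => // f [j]; rewrite inE => /andP[/orP[/eqP ->|js] Pj] Aj.
    by left.
  by right; exists j => //; rewrite js.
apply: le_trans IH; apply: le_config_prob => // f [j].
rewrite inE => /andP[/orP[/eqP ->|js] Pj] Aj; first by rewrite Pj in Pi.
by exists j => //; rewrite js.
Qed.

End Law.

(** The fibre of a restriction map is a product, some of whose factors are
    reduced to one point: [esum_ffun] computes its mass. *)
Lemma config_prob_marginal (K K' : finType) (iota : K' -> K) (r : K -> R)
    (A : set {ffun K' -> nat}) : injective iota -> subunit r ->
  config_prob r [set f | A [ffun k => f (iota k)]] = config_prob (r \o iota) A.
Proof.
move=> inj hr.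
have p0 f : (0 <= (config_pmf r f)%:E)%E by rewrite lee_fin config_pmf_ge0.
pose res (f : {ffun K -> nat}) : {ffun K' -> nat} := [ffun k => f (iota k)].
transitivity (\esum_(g in A) \esum_(f in [set f | res f = g]) (config_pmf r f)%:E).
  rewrite esum_esum//; apply: reindex_esum; split.
  - by move=> [g f] [Ag /= E]; rewrite /= -/(res f) E.
  - move=> [g f] [g' f']; rewrite !inE => -[/= _ <-] [/= _ <-] /= ff'.
    by rewrite ff'.
  - by move=> f Af; exists (res f, f).
apply: eq_esum => g _.
pose p (i : K) (k : nat) : R := geometric_pmf (r i) k *
  (if [pick j | iota j == i] is Some j then (k == g j)%:R else 1).
pose s (i : K) : R :=
  if [pick j | iota j == i] is Some j then geometric_pmf (r i) (g j) else 1.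
have pE (f : {ffun K -> nat}) : \prod_i p i (f i) = config_pmf r f * (res f == g)%:R.
  rewrite big_split /=; congr (_ * _).
  have [<-|ne] := eqVneq (res f) g.
    apply: big1 => i _; case: pickP => // j /eqP <-.
    by rewrite ffunE eqxx.
  have /existsNP[j /eqP nj] : ~ (forall j, res f j = g j) by move/ffunP; apply/eqP.
  rewrite (bigD1 (iota j)) //=; case: pickP => [j' /eqP /inj ->|/(_ j)]; last by rewrite eqxx.
  by move: nj; rewrite ffunE => /negbTE ->; rewrite mul0r.
transitivity (\esum_(f in [set: {ffun K -> nat}]) (\prod_i p i (f i))%:E).
  rewrite esum_mkcond; apply: eq_esum => f _; rewrite pE.
  rewrite (_ : (f \in _) = (res f == g)); last by apply/idP/eqP; rewrite inE.
  by case: eqP; rewrite ?mulr1 ?mulr0.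
rewrite (@esum_ffun _ K p s); first congr (_%:E).
- rewrite (bigID (mem (iota @: predT))) /= [X in _ * X]big1 ?mulr1; last first.
    move=> i ni; rewrite /s; case: pickP => // j /eqP ij.
    by move: ni; rewrite -ij imset_f.
  rewrite big_imset /=; last by move=> x y _ _; apply: inj.
  rewrite /config_pmf; apply: eq_big => [j|j _]; first by rewrite inE.
  rewrite /s; case: pickP => [j' /eqP /inj ->//|/(_ j)]; by rewrite eqxx.
- move=> i k; rewrite /p mulr_ge0 ?geometric_pmf_ge0//.
  by case: pickP => // j _; case: (_ == _).
move=> i; rewrite /p /s; have /andP[r0 r1] := hr i; case: pickP => [j _|_].
  rewrite (esum_mkcond setT) (_ : (fun k => _) = fun k =>
     if k \in [set g j] then (geometric_pmf (r i) k)%:E else 0%E); last first.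
    apply/funext => k; rewrite in_setT; have [->|ne] := eqVneq k (g j).
      by rewrite mem_set// mulr1.
    by rewrite memNset ?mulr0//= => /eqP; apply/negP.
  by rewrite -esum_mkcond esum_set1// lee_fin geometric_pmf_ge0.
under eq_esum do rewrite mulr1.
by rewrite esum_geometric ?divff ?subr_ge0 ?ltW ?r0// subr_eq0 gt_eqF.
Qed.

End GeometricConfigurations.

(** * The Burke property *)

Section BoxConfigurations.
Context {R : realType}.

(** The indices of the data of a field in a box: bottom edges, left edges and
   cells. *)
Definition box n m := ('I_n + 'I_m + 'I_n * 'I_m)%type.

Definition box_parameter n m (a b : R) (x : box n m) : R :=
  match x with inl (inl _) => a | inl (inr _) => b | inr _ => a * b end.

Lemma box_parameter_subunit n m a b :
  0 < a < 1 -> 0 < b < 1 -> subunit (@box_parameter n m a b).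
Proof.
by move=> /andP[? ?] /andP[? ?] [[_|_]|_] /=; apply/andP; split=> //; nra.
Qed.

Section Fields.
Variables n m : nat.
Implicit Types f : {ffun box n m -> nat}.

Definition bottomI f i : nat := oapp (fun o => f (inl (inl o))) 0%N (insub i).
Definition leftJ f j : nat := oapp (fun o => f (inl (inr o))) 0%N (insub j).
Definition innerE f i j : nat :=
  if (insub i, insub j) is (Some o, Some o') then f (inr (o, o')) else 0%N.

Lemma bottomI_ord f (i : 'I_n) : bottomI f i = f (inl (inl i)).
Proof. by rewrite /bottomI valK. Qed.
Lemma leftJ_ord f (j : 'I_m) : leftJ f j = f (inl (inr j)).
Proof. by rewrite /leftJ valK. Qed.
Lemma innerE_ord f (i : 'I_n) (j : 'I_m) : innerE f i j = f (inr (i, j)).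
Proof. by rewrite /innerE !valK. Qed.

Definition fieldI f := incI (bottomI f) (leftJ f) (innerE f).
Definition fieldJ f := incJ (bottomI f) (leftJ f) (innerE f).
Definition fieldV f := bulk (bottomI f) (leftJ f) (innerE f).
Definition fieldH f := height (bottomI f) (leftJ f) (innerE f).

(** The configuration read off the field from the opposite corner of the box. *)
Definition reversal f : {ffun box n m -> nat} :=
  [ffun x : box n m => match x with
    | inl (inl i) => fieldI f (n - i.+1) m
    | inl (inr j) => fieldJ f n (m - j.+1)
    | inr (i, j) => fieldV f (n - i.+1) (m - j.+1)
    end].

Lemma bottomI_reversal f i : (i < n)%N ->
  bottomI (reversal f) i = fieldI f (n - i.+1) m.
Proof. by move=> ni; have := bottomI_ord (reversal f) (Ordinal ni); rewrite ffunE. Qed.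

Lemma leftJ_reversal f j : (j < m)%N ->
  leftJ (reversal f) j = fieldJ f n (m - j.+1).
Proof. by move=> jm; have := leftJ_ord (reversal f) (Ordinal jm); rewrite ffunE. Qed.

Lemma innerE_reversal f i j : (i < n)%N -> (j < m)%N ->
  innerE (reversal f) i j = fieldV f (n - i.+1) (m - j.+1).
Proof.
by move=> ni jm; have := innerE_ord (reversal f) (Ordinal ni) (Ordinal jm); rewrite ffunE.
Qed.

Lemma reversal_fields f :
  (forall i j, (i < n)%N -> (j <= m)%N ->
     fieldI (reversal f) i j = fieldI f (n - i.+1) (m - j)) /\
  (forall i j, (i <= n)%N -> (j < m)%N ->
     fieldJ (reversal f) i j = fieldJ f (n - i) (m - j.+1)).
Proof.
apply: reverse_incI_incJ.
- exact: bottomI_reversal.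
- exact: leftJ_reversal.
- exact: innerE_reversal.
Qed.

(** The second reading meets the original boundary values; in the cells it takes
    the minimum of eta + (I - J)^+ and eta + (J - I)^+, which is eta. *)
Lemma reversalK : involutive reversal.
Proof.
move=> f; have [HI HJ] := reversal_fields f.
apply/ffunP => -[[i|j]|[i j]]; rewrite ffunE.
- rewrite HI ?leqnn//; last by have := ltn_ord i; lia.
  rewrite subnn (_ : (n - (n - i.+1).+1 = i)%N); last by have := ltn_ord i; lia.
  by rewrite /fieldI /incI /= bottomI_ord.
- rewrite HJ ?leqnn//; last by have := ltn_ord j; lia.
  rewrite subnn (_ : (m - (m - j.+1).+1 = j)%N); last by have := ltn_ord j; lia.
  by rewrite /fieldJ /= leftJ_ord.
rewrite /fieldV /bulk -!/(fieldI _ _ _) -!/(fieldJ _ _ _).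
have ni := ltn_ord i; have jm := ltn_ord j.
rewrite HI ?HJ; try lia.
rewrite (_ : (n - (n - i.+1).+1 = i)%N); last lia.
rewrite (_ : (m - (m - j.+1).+1 = j)%N); last lia.
rewrite (_ : (n - (n - i.+1) = i.+1)%N); last lia.
rewrite (_ : (m - (m - j.+1) = j.+1)%N); last lia.
rewrite /fieldI /fieldJ incIS incJS innerE_ord.
move: (f _) (incI _ _ _ _ _) (incJ _ _ _ _ _) => z x y; clear; lia.
Qed.

Definition exponentI f : nat :=
  \sum_(0 <= i < n) bottomI f i + \sum_(0 <= i < n) \sum_(0 <= j < m) innerE f i j.
Definition exponentJ f : nat :=
  \sum_(0 <= j < m) leftJ f j + \sum_(0 <= i < n) \sum_(0 <= j < m) innerE f i j.

Lemma sum_reversed k (F : nat -> nat) :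
  (\sum_(0 <= i < k) F (k - i.+1) = \sum_(0 <= i < k) F i)%N.
Proof. by rewrite [RHS]big_nat_rev. Qed.

Lemma sum_innerE_reversal f :
  (\sum_(0 <= i < n) \sum_(0 <= j < m) innerE (reversal f) i j =
   \sum_(0 <= i < n) \sum_(0 <= j < m) fieldV f i j)%N.
Proof.
rewrite -(sum_reversed _ (fun i => \sum_(0 <= j < m) fieldV f i j)%N).
apply: eq_big_nat => i /= ni; rewrite -[RHS]sum_reversed.
by apply: eq_big_nat => j /= jm; apply: innerE_reversal.
Qed.

Lemma exponentI_reversal f : exponentI (reversal f) = exponentI f.
Proof.
rewrite /exponentI sum_innerE_reversal.
rewrite (eq_big_nat _ _ (F2 := fun i => fieldI f (n - i.+1) m)); last first.
  by move=> i ni; apply: bottomI_reversal.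
rewrite (sum_reversed _ (fun i => fieldI f i m)) -!big_split /=.
by apply: eq_bigr => i _; rewrite -incI_balance.
Qed.

Lemma exponentJ_reversal f : exponentJ (reversal f) = exponentJ f.
Proof.
rewrite /exponentJ sum_innerE_reversal.
rewrite (eq_big_nat _ _ (F2 := fun j => fieldJ f n (m - j.+1))); last first.
  by move=> j jm; apply: leftJ_reversal.
rewrite (sum_reversed _ (fun j => fieldJ f n j)).
rewrite [X in (_ + X = _)%N]exchange_big [X in (_ = _ + X)%N]exchange_big -!big_split /=.
by apply: eq_bigr => j _; rewrite -incJ_balance.
Qed.

(** The mass of a configuration depends only on the two exponents, as the
   parameter of the cells is the product of the two others. *)
Lemma config_pmf_box (a b : R) f :
  config_pmf (box_parameter a b) f =
  (\prod_x (1 - @box_parameter n m a b x)) * (a ^+ exponentI f * b ^+ exponentJ f).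
Proof.
rewrite /config_pmf big_split /=; congr (_ * _).
rewrite big_sumType big_sumType /= !prodrXr /exponentI /exponentJ.
have -> : (\sum_(x : 'I_n * 'I_m) f (inr x) =
    \sum_(0 <= i < n) \sum_(0 <= j < m) innerE f i j)%N.
  rewrite big_mkord (eq_bigr (fun x : 'I_n * 'I_m => f (inr (x.1, x.2)))); last by case.
  rewrite -(pair_bigA _ (fun i j => f (inr (i, j)))) /=.
  by apply: eq_bigr => i _; rewrite big_mkord; apply: eq_bigr => j _; rewrite innerE_ord.
rewrite !big_mkord.
rewrite (eq_bigr (fun i : 'I_n => bottomI f i)); last by move=> i _; rewrite bottomI_ord.
rewrite [X in b ^+ X](eq_bigr (fun j : 'I_m => leftJ f j)); last by move=> j _; rewrite leftJ_ord.
rewrite !exprD exprMn.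
by rewrite mulrACA !mulrA.
Qed.

Lemma config_pmf_reversal (a b : R) f :
  config_pmf (box_parameter a b) (reversal f) = config_pmf (box_parameter a b) f.
Proof. by rewrite !config_pmf_box exponentI_reversal exponentJ_reversal. Qed.

(** The Burke property: a bijection which preserves the mass of every
    configuration preserves the law. *)
Lemma config_prob_reversal (a b : R) (A : set {ffun box n m -> nat}) :
  config_prob (box_parameter a b) [set f | A (reversal f)] =
  config_prob (box_parameter a b) A.
Proof.
rewrite /config_prob (reindex_esum [set f | A (reversal f)] A reversal).
  by apply: eq_esum => f _; rewrite config_pmf_reversal.
split=> // [f g _ _|f Af]; first exact: (can_inj reversalK).
by exists (reversal f); rewrite /= ?reversalK.
Qed.

End Fields.
End BoxConfigurations.

Section BoxMarginals.
Context {R : realType}.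
Variables (a b : R).
Hypotheses (ha : 0 < a < 1) (hb : 0 < b < 1).

Lemma prob_bottomI n m i0 d (A : set nat) : (i0 + d <= n)%N ->
  config_prob (@box_parameter R n m a b)
    [set f | A (\sum_(0 <= i < d) bottomI f (i0 + i))%N] =
  config_prob (fun _ : 'I_d => a) [set g | A (\sum_i g i)%N].
Proof.
move=> dn.
have lt (i : 'I_d) : (i0 + i < n)%N by have := ltn_ord i; lia.
pose iota (i : 'I_d) : box n m := inl (inl (Ordinal (lt i))).
rewrite -(@config_prob_marginal _ _ _ iota (box_parameter a b) [set g | A (\sum_i g i)%N]).
- congr config_prob; apply/seteqP.
  suff E (f : {ffun box n m -> nat}) :
    (\sum_(0 <= i < d) bottomI f (i0 + i) = \sum_i [ffun k => f (iota k)] i)%N.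
    by split=> f /=; rewrite E.
  rewrite big_mkord; apply: eq_bigr => i _; rewrite ffunE.
  by rewrite -(bottomI_ord f (Ordinal (lt i))).
- by move=> i j [] /addnI /val_inj.
- exact: box_parameter_subunit.
Qed.

Lemma prob_leftJ m n (A : set nat) :
  config_prob (@box_parameter R n m a b)
    [set f | A (\sum_(0 <= j < m) leftJ f j)%N] =
  config_prob (fun _ : 'I_m => b) [set g | A (\sum_j g j)%N].
Proof.
pose iota (j : 'I_m) : box n m := inl (inr j).
rewrite -(@config_prob_marginal _ _ _ iota (box_parameter a b) [set g | A (\sum_j g j)%N]).
- congr config_prob; apply/seteqP.
  suff E (f : {ffun box n m -> nat}) :
    (\sum_(0 <= j < m) leftJ f j = \sum_j [ffun k => f (iota k)] j)%N.
    by split=> f /=; rewrite E.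
  by rewrite big_mkord; apply: eq_bigr => j _; rewrite ffunE leftJ_ord.
- by move=> i j [].
- exact: box_parameter_subunit.
Qed.

(** Vertical increments on an inner line are those on the right side of a
    smaller box, and hence, after reversal, boundary data of that box. *)
Lemma prob_fieldJ n m k j (A : set nat) : (k <= n)%N -> (j <= m)%N ->
  config_prob (@box_parameter R n m a b)
    [set f | A (\sum_(0 <= j' < j) fieldJ f k j')%N] =
  config_prob (fun _ : 'I_j => b) [set g | A (\sum_j' g j')%N].
Proof.
move=> kn jm.
pose iota (x : box k j) : box n m := match x with
  | inl (inl i) => inl (inl (widen_ord kn i))
  | inl (inr i) => inl (inr (widen_ord jm i))
  | inr (i, i') => inr (widen_ord kn i, widen_ord jm i') end.
pose A' := [set f : {ffun box k j -> nat} | A (\sum_(0 <= j' < j) fieldJ f k j')%N].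
transitivity (config_prob (@box_parameter R n m a b)
    [set f | A' [ffun x => f (iota x)]]).
  congr config_prob; apply/seteqP.
  suff E (f : {ffun box n m -> nat}) j' : (j' < j)%N ->
      fieldJ f k j' = fieldJ [ffun x => f (iota x)] k j'.
    have S (f : {ffun box n m -> nat}) : (\sum_(0 <= j' < j) fieldJ f k j' =
        \sum_(0 <= j' < j) fieldJ [ffun x => f (iota x)] k j')%N.
      by apply: eq_big_nat => j' /= ?; apply: E.
    by split=> f; rewrite /A' /= S.
  move=> j'j; rewrite /fieldJ; have [|||_ ->//] := @eq_incI_incJ k j (bottomI f) (leftJ f) (innerE f)
    (bottomI [ffun x => f (iota x)]) (leftJ [ffun x => f (iota x)])
    (innerE [ffun x => f (iota x)]).
  - move=> i ik; have := bottomI_ord [ffun x => f (iota x)] (Ordinal ik).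
    by rewrite ffunE /= => ->; rewrite -bottomI_ord.
  - move=> i ij; have := leftJ_ord [ffun x => f (iota x)] (Ordinal ij).
    by rewrite ffunE /= => ->; rewrite -leftJ_ord.
  - move=> i i' ik ij; have := innerE_ord [ffun x => f (iota x)] (Ordinal ik) (Ordinal ij).
    by rewrite ffunE /= => ->; rewrite -innerE_ord.
rewrite config_prob_marginal; last 2 first.
- move=> [[x|x]|[x x']] [[y|y]|[y y']] //= [].
  + by move=> ?; congr (inl (inl _)); apply/val_inj.
  + by move=> ?; congr (inl (inr _)); apply/val_inj.
  + by move=> ? ?; congr (inr (_, _)); apply/val_inj.
- exact: box_parameter_subunit.
rewrite (_ : _ \o _ = @box_parameter R k j a b); last by apply/funext => -[[]|[]].
rewrite -(prob_leftJ _ k) -[RHS]config_prob_reversal; congr config_prob; apply/seteqP.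
suff E (f : {ffun box k j -> nat}) : (\sum_(0 <= j' < j) fieldJ f k j' =
    \sum_(0 <= j' < j) leftJ (reversal f) j')%N.
  by split=> f; rewrite /A' /= E.
rewrite -sum_reversed; apply: eq_big_nat => j' /= j'j.
by rewrite leftJ_reversal.
Qed.

(** After reversal the weights are the cells of the configuration. *)
Lemma prob_fieldV n m (A : set {ffun 'I_n * 'I_m -> nat}) :
  config_prob (@box_parameter R n m a b)
    [set f | A [ffun x : 'I_n * 'I_m => fieldV f x.1 x.2]] =
  config_prob (fun _ => a * b) A.
Proof.
pose iota (x : 'I_n * 'I_m) : box n m := inr (rev_ord x.1, rev_ord x.2).
have inj_iota : injective iota.
  by move=> [x y] [x' y'] [] /= ex ey; congr pair; apply/rev_ord_inj/val_inj.
rewrite -(@config_prob_marginal _ _ _ iota (box_parameter a b) A inj_iota); last first.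
  exact: box_parameter_subunit.
rewrite -[RHS]config_prob_reversal; congr config_prob; apply/seteqP.
suff E (f : {ffun box n m -> nat}) : [ffun x : 'I_n * 'I_m => fieldV f x.1 x.2] =
    [ffun k => reversal f (iota k)] by split=> f /=; rewrite E.
apply/ffunP => -[x y]; rewrite !ffunE /=.
by have := ltn_ord x; have := ltn_ord y => *; congr fieldV; lia.
Qed.

End BoxMarginals.

(** * Exponential deviation bounds *)

Section Chernoff.
Context {R : realType}.

(** Multiplying the mass function by exp(theta f) replaces the parameter a by
    a exp(theta); the ratio of the normalizations is the generating function. *)
Lemma exponential_markov m (a theta x : R) : 0 < a < 1 -> a * expR theta < 1 ->
  (config_prob (fun _ : 'I_m => a)
     [set f : {ffun 'I_m -> nat} | (theta * x <= theta * (\sum_i f i)%N%:R)%R] <=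
   (((1 - a) / (1 - a * expR theta)) ^+ m * expR (- (theta * x)))%:E)%E.
Proof.
move=> /andP[a0 a1] az1; set z := expR theta.
have z0 : 0 < z by apply: expR_gt0.
pose p (i : 'I_m) k : R := (1 - a) * (a * z) ^+ k.
have p0 i k : 0 <= p i k.
  by rewrite /p mulr_ge0 ?subr_ge0 ?exprn_ge0 ?mulr_ge0// ltW.
have := @esum_ffun R _ p (fun _ => (1 - a) / (1 - a * z)) p0.
rewrite prodr_const card_ord => H.
rewrite [X in (_ <= X%:E)%E]mulrC EFinM -H; last first.
  by move=> i; apply: esum_geometric; rewrite ?subr_ge0 ?ltW// mulr_gt0.
rewrite -esumZl ?expR_ge0//; last by move=> f; rewrite lee_fin prodr_ge0.
rewrite /config_prob esum_mkcond; apply: le_esum => f _; rewrite -EFinM.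
case: ifPn => [|_]; last by rewrite lee_fin mulr_ge0 ?expR_ge0 ?prodr_ge0.
rewrite inE /= => hx; rewrite lee_fin.
have -> : \prod_i p i (f i) = config_pmf (fun _ : 'I_m => a) f * expR (theta * (\sum_i f i)%N%:R).
  rewrite /config_pmf expRM_natr -prodrXr -big_split /=.
  by apply: eq_bigr => i _; rewrite /p /geometric_pmf exprMn -/z; ring.
rewrite mulrCA -expRD; apply: ler_peMr.
  by apply: config_pmf_ge0 => i; rewrite a0.
by rewrite -[X in X <= _]expR0 ler_expR; lra.
Qed.

Lemma expR_le_quadratic (x : R) : x <= 2^-1 -> expR x <= 1 + x + 2 * x ^+ 2.
Proof.
move=> hx; have /= h := expR_ge1Dx (- x).
have e0 := expR_gt0 x; have E : expR x * expR (- x) = 1 by rewrite expRxMexpNx_1.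
have B : (1 - x) * expR x <= 1 by rewrite -[leRHS]E mulrC ler_pM2l.
have h2 : 0 <= x ^+ 2 * (1 - 2 * x) by rewrite mulr_ge0 ?sqr_ge0//; lra.
rewrite -(ler_pM2l (_ : 0 < 1 - x)); last lra.
by apply: le_trans B _; lra.
Qed.

(** The logarithm of the generating function of a centred geometric variable
    vanishes to the second order at 0, so that a small tilt, of either sign,
    gains more from a deviation delta than it loses. *)
Lemma tilted_base (a delta : R) (sigma : bool) : 0 < a < 1 -> 0 < delta <= 1 ->
  exists2 t, 0 < t & let theta := (-1) ^+ sigma * t in
    a * expR theta < 1 /\
    (1 - a) / (1 - a * expR theta) * expR (- (theta * (a / (1 - a)) + delta * t)) < 1.
Proof.
move=> /andP[a0 a1] /andP[d0 d1]; set mu := a / (1 - a).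
have mu0 : 0 < mu by rewrite divr_gt0 ?subr_gt0.
have muE : mu * (1 - a) = a by rewrite /mu divfK ?gt_eqF ?subr_gt0.
have [t tE tgt0] : exists2 t, t * (4 * (1 + mu + delta)) <= (1 - a) * delta & 0 < t.
  exists ((1 - a) * delta / (4 * (1 + mu + delta))).
    by rewrite divfK// gt_eqF; lra.
  by rewrite divr_gt0 ?mulr_gt0; lra.
exists t => // theta.
have t4 : t <= 4^-1 by nra.
have theta2 : theta ^+ 2 = t ^+ 2 by rewrite /theta exprMn sqrr_sign mul1r.
have [s [sE s2]] : exists s : R, theta = s * t /\ (s = 1 \/ s = -1).
  exists ((-1) ^+ sigma); by split=> //; case: (sigma); [right; rewrite expr1|left; rewrite expr0].
have ez : expR theta <= 1 + theta + 2 * t ^+ 2.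
  rewrite -theta2; apply: expR_le_quadratic; rewrite sE.
  by case: s2 => ->; lra.
have az : a * expR theta <= a * (1 + theta + 2 * t ^+ 2) by rewrite ler_pM2l.
have az1 : a * expR theta < 1.
  apply: le_lt_trans az _; rewrite sE expr2.
  by case: s2 => ->; nra.
split=> //.
rewrite mulrAC ltr_pdivrMr ?subr_gt0// mul1r expRN ltr_pdivrMr ?expR_gt0//.
have /= ex := expR_ge1Dx (theta * mu + delta * t).
pose u := s * mu + delta.
have uE : theta * mu + delta * t = t * u by rewrite sE /u; ring.
have tu1 : - 1 <= t * u <= 1 by rewrite /u; apply/andP; case: s2 => ->; split; nra.
have su : s * u <= mu + delta by rewrite /u; case: s2 => ->; lra.
have t2 : 0 < t * t by rewrite mulr_gt0.
have key : 1 - a < (1 - a * expR theta) * (1 + t * u).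
  apply: (@lt_le_trans _ _ ((1 - a - a * theta - 2 * a * (t * t)) * (1 + t * u))).
    rewrite [ltRHS](_ : _ = 1 - a + t * ((1 - a) * delta - a * (t * (s * u))
        - 2 * a * t * (1 + t * u))); last first.
      have : s * t * (mu * (1 - a)) = s * t * a by rewrite muE.
      by rewrite sE /u; move: (mu) => mu'; lra.
    rewrite ltrDl; apply: mulr_gt0 => //.
    have h1 : a * (t * (s * u)) <= t * (mu + delta).
      apply: le_trans (_ : a * (t * (mu + delta)) <= _).
        by rewrite ler_pM2l// ler_pM2l.
      by rewrite ler_piMl ?(ltW a1)// mulr_ge0 ?ltW// addr_gt0.
    have h2 : 2 * a * t * (1 + t * u) <= 4 * t * a.
      rewrite (_ : 4 * t * a = 2 * a * t * 2); last by ring.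
      by rewrite ler_pM2l ?mulr_gt0//; lra.
    have h3 : 4 * t * a < 4 * t by rewrite gtr_pMr ?mulr_gt0.
    have h4 : 0 < t * (mu + delta) by rewrite mulr_gt0// addr_gt0.
    by move: tE h1 h2 h3 h4; lra.
  apply: ler_wpM2r; first lra.
  by move: az; rewrite expr2; lra.
rewrite uE in ex *; apply: lt_le_trans key _.
by rewrite ler_pM2l//; lra.
Qed.

End Chernoff.

Section Deviations.
Context {R : realType}.

Definition geometric_mean (a : R) := a / (1 - a).

Lemma chernoff_sided (a delta : R) (sigma : bool) : 0 < a < 1 -> 0 < delta <= 1 ->
  exists2 rho, 0 < rho < 1 & forall m N (x : R), (m <= N)%N ->
    delta * N%:R <= (-1) ^+ sigma * (x - m%:R * geometric_mean a) ->
    (config_prob (fun _ : 'I_m => a)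
      [set f : {ffun 'I_m -> nat} |
         ((-1) ^+ sigma * x <= (-1) ^+ sigma * (\sum_i f i)%N%:R)%R] <=
     (rho ^+ N)%:E)%E.
Proof.
move=> ha hd; have [t t0 /=] := tilted_base sigma ha hd; set theta := _ * t => -[az1 base].
have /andP[a0 a1] := ha; have /andP[d0 d1] := hd.
set phi := (1 - a) / (1 - a * expR theta) in base.
have phi0 : 0 < phi by rewrite divr_gt0// subr_gt0.
pose kappa := phi * expR (- (theta * geometric_mean a)).
have kappa0 : 0 < kappa by rewrite mulr_gt0// expR_gt0.
pose rho := Num.max 1 kappa * expR (- (delta * t)).
exists rho.
  apply/andP; split; first by rewrite mulr_gt0 ?expR_gt0// lt_max ltr01.
  rewrite /rho; have [k1|k1] := leP 1 kappa.
    by rewrite /kappa -mulrA -expRD -opprD.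
  by rewrite mul1r -expR0 ltr_expR oppr_lt0 mulr_gt0.
move=> m N x mN hx.
apply: le_trans (_ : ((phi ^+ m * expR (- (theta * x)))%:E <= _)%E).
  apply: le_trans (exponential_markov m x ha az1).
  apply: le_config_prob; first by move=> i.
  by move=> f /=; rewrite /theta !(mulrAC _ t) ler_pM2r.
rewrite lee_fin.
rewrite (_ : phi ^+ m * _ =
   kappa ^+ m * expR (- (theta * (x - m%:R * geometric_mean a)))); last first.
  rewrite /kappa [in RHS]exprMn -expRM_natr -[RHS]mulrA -expRD; congr (_ * expR _); ring.
rewrite /rho [in leRHS]exprMn -expRM_natr; apply: ler_pM; rewrite ?exprn_ge0 ?expR_ge0 ?(ltW kappa0)//.
  apply: (@le_trans _ _ (Num.max 1 kappa ^+ m)).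
    by apply: lerXn2r; rewrite ?nnegrE ?le_max ?lexx ?orbT ?ler01 ?(ltW kappa0).
  by apply: ler_weXn2l => //; rewrite le_max lexx.
rewrite ler_expR /theta; move: hx; rewrite -(ler_pM2r t0).
by move: ((-1) ^+ sigma) => sgn; lra.
Qed.

(** The number of variables m may be much smaller than N, even zero: deviations
    are measured on the scale N. *)
Lemma geometric_chernoff (a delta : R) : 0 < a < 1 -> 0 < delta <= 1 ->
  exists2 rho, 0 < rho < 1 & forall m N (x : R), (m <= N)%N ->
    (m%:R * geometric_mean a + delta * N%:R <= x ->
     (config_prob (fun _ : 'I_m => a)
       [set f : {ffun 'I_m -> nat} | (x <= (\sum_i f i)%N%:R)%R] <= (rho ^+ N)%:E)%E) /\
    (x <= m%:R * geometric_mean a - delta * N%:R ->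
     (config_prob (fun _ : 'I_m => a)
       [set f : {ffun 'I_m -> nat} | ((\sum_i f i)%N%:R <= x)%R] <= (rho ^+ N)%:E)%E).
Proof.
move=> ha hd.
have [r1 /andP[r10 r11] H1] := chernoff_sided false ha hd.
have [r2 /andP[r20 r21] H2] := chernoff_sided true ha hd.
exists (Num.max r1 r2); first by rewrite lt_max r10 gt_max r11.
move=> m N x mN; split=> hx.
  apply: le_trans (_ : (r1 ^+ N)%:E <= _)%E; last first.
    by rewrite lee_fin; apply: lerXn2r; rewrite ?nnegrE ?le_max ?lexx// ltW.
  apply: le_trans (H1 m N x mN _); last by rewrite expr0 mul1r; lra.
  by apply: le_config_prob => // f /=; rewrite expr0 !mul1r.
apply: le_trans (_ : (r2 ^+ N)%:E <= _)%E; last first.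
  by rewrite lee_fin; apply: lerXn2r; rewrite ?nnegrE ?le_max ?lexx ?orbT// ltW.
apply: le_trans (H2 m N x mN _); last by rewrite expr1 mulN1r; lra.
by apply: le_config_prob => // f /=; rewrite expr1 !mulN1r lerN2.
Qed.

End Deviations.

(** * Comparison at far points of a sector *)

Section BoxBound.
Context {R : realType}.

Definition extend n m (v : {ffun 'I_n * 'I_m -> nat}) i j : nat :=
  if (insub i, insub j) is (Some o, Some o') then v (o, o') else 0%N.

Lemma extend_ord n m (v : {ffun 'I_n * 'I_m -> nat}) (i : 'I_n) (j : 'I_m) :
  extend v i j = v (i, j).
Proof. by rewrite /extend !valK. Qed.

(** Subtracting the smaller value, plus c, from the larger one makes the two
    coordinates independent again. *)
Lemma prob_initial_difference (a b : R) n c : 0 < a < 1 -> 0 < b < 1 -> (0 < n)%N ->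
  config_prob (@box_parameter R n n a b)
    [set f | (leftJ f 0 + c <= bottomI f 0)%N] =
  (a ^+ c * (1 - b) / (1 - a * b))%:E.
Proof.
move=> ha hb n0; have /andP[a0 a1] := ha; have /andP[b0 b1] := hb.
have ab : 0 <= a * b < 1 by apply/andP; split; nra.
pose o := Ordinal n0.
pose iota (x : bool) : box n n := if x then inl (inl o) else inl (inr o).
pose r (x : bool) := if x then a else b.
have -> : [set f : {ffun box n n -> nat} | (leftJ f 0 + c <= bottomI f 0)%N] =
    [set f | [set g : {ffun bool -> nat} | (g false + c <= g true)%N] [ffun x => f (iota x)]].
  by apply/seteqP; split=> f /=; rewrite !ffunE -(leftJ_ord f o) -(bottomI_ord f o).
rewrite config_prob_marginal; last 2 first.
- by move=> [] [].
- exact: box_parameter_subunit.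
rewrite (_ : _ \o iota = r); last by apply/funext => -[].
pose shear (h : {ffun bool -> nat}) : {ffun bool -> nat} :=
  [ffun x : bool => if x then h false + c + h true else h false]%N.
rewrite /config_prob (reindex_esum setT _ shear); last first.
  split=> [h _|h h' _ _ E|g /= gc].
  - by rewrite /= !ffunE leq_addr.
  - have := congr1 (fun g : {ffun bool -> nat} => g false) E; rewrite !ffunE => e0.
    have := congr1 (fun g : {ffun bool -> nat} => g true) E; rewrite !ffunE e0 => e1.
    by apply/ffunP => -[]; [exact: addnI e1|exact: e0].
  - exists [ffun x : bool => if x then g true - (g false + c) else g false]%N => //.
    by apply/ffunP => -[]; rewrite !ffunE //= subnKC.
pose p (x : bool) k := if x then (1 - a) * a ^+ k else a ^+ c * (1 - b) * (a * b) ^+ k.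
pose S (x : bool) := if x then (1 - a) / (1 - a) else a ^+ c * (1 - b) / (1 - a * b).
transitivity (\esum_(h in [set: {ffun bool -> nat}]) (\prod_x p x (h x))%:E).
  apply: eq_esum => h _; congr (_%:E).
  rewrite /config_pmf !big_bool !ffunE /= /p /geometric_pmf !exprD exprMn.
  by move: (a ^+ _) (a ^+ _) (a ^+ _) (b ^+ _) => x y z w; rewrite /r; ring.
rewrite (@esum_ffun _ _ p S).
- rewrite big_bool /S /= divff ?mul1r//; last by rewrite subr_eq0 gt_eqF.
- by move=> [] k; rewrite /p ?mulr_ge0 ?exprn_ge0 ?subr_ge0 ?mulr_ge0 ?ltW.
- move=> []; rewrite /p /S; apply: esum_geometric => //.
  + by rewrite subr_ge0 ltW.
  + by rewrite (ltW a0) a1.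
  + by rewrite mulr_ge0 ?exprn_ge0 ?subr_ge0 ?(ltW a0) ?(ltW b1).
Qed.

(** The weights V have the same law for all fields with the same a b, so that an
    event about the weights may be moved from one field to another. *)
Lemma prob_lpp1_ge (a b a' b' : R) n m k j (r : R) :
  0 < a < 1 -> 0 < b < 1 -> 0 < a' < 1 -> 0 < b' < 1 -> a * b = a' * b' ->
  (k.+1 < n)%N -> (j < m)%N ->
  config_prob (@box_parameter R n m a b)
    [set f | r <= (lpp (shift1 (fieldV f)) k j)%:R] =
  config_prob (@box_parameter R n m a' b')
    [set f | r <= (lpp (shift1 (fieldV f)) k j)%:R].
Proof.
move=> ha hb ha' hb' E kn jm.
pose A := [set v : {ffun 'I_n * 'I_m -> nat} | r <= (lpp (shift1 (extend v)) k j)%:R].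
have H : [set f : {ffun box n m -> nat} | r <= (lpp (shift1 (fieldV f)) k j)%:R] =
    [set f | A [ffun x : 'I_n * 'I_m => fieldV f x.1 x.2]].
  suff L (f : {ffun box n m -> nat}) : lpp (shift1 (fieldV f)) k j =
      lpp (shift1 (extend [ffun x : 'I_n * 'I_m => fieldV f x.1 x.2])) k j.
    by apply/seteqP; split=> f; rewrite /A /= L.
  apply: eq_lpp => i j' ik jj; rewrite /shift1.
  have ni : (i.+1 < n)%N by lia.
  have mj : (j' < m)%N by lia.
  by rewrite (extend_ord _ (Ordinal ni) (Ordinal mj)) ffunE.
by rewrite H !prob_fieldV// E.
Qed.

Lemma height_ge_lpp1 n m (f : {ffun box n m -> nat}) k j :
  (lpp (shift1 (fieldV f)) k j <= \sum_(0 <= i < k.+1) bottomI f (0 + i) +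
     \sum_(0 <= j' < j) fieldJ f k.+1 j')%N.
Proof.
exact: leq_trans (leq_addr _ _) (lpp1_height (bottomI f) (leftJ f) (innerE f) k j).
Qed.

Lemma fieldH_succ n m (f : {ffun box n m -> nat}) k j :
  fieldH f k.+1 j = (\sum_(0 <= i < k) bottomI f (1 + i) +
     \sum_(0 <= j' < j) fieldJ f k.+1 j' + fieldI f 0 0)%N.
Proof.
rewrite /fieldH /height big_nat_recl// -addnA addnC; congr (_ + _)%N.
Qed.

(** If the mean of the field of parameters a', b' at (k+1, j) is smaller than the
    mean of the field of parameters a, b by a macroscopic amount, the latter
    is attained by a last-passage time only with exponentially small
    probability: such a time is bounded by the former field, whose weights have
    the same law. Both heights are sums of independent increments along a
    bottom line and a vertical line. *)
Lemma prob_exact (a b a' b' delta : R) :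
  0 < a < 1 -> 0 < b < 1 -> 0 < a' < 1 -> 0 < b' < 1 -> a * b = a' * b' ->
  0 < delta <= 1 ->
  exists2 rho, 0 < rho < 1 & forall n m k j, (k.+1 < n)%N -> (j < m)%N ->
    k.+1%:R * geometric_mean a' + j%:R * geometric_mean b' +
      4 * delta * (k.+1 + j)%:R <=
    k%:R * geometric_mean a + j%:R * geometric_mean b ->
    (config_prob (@box_parameter R n m a b)
      [set f | (fieldH f k.+1 j <= lpp (shift1 (fieldV f)) k j + fieldI f 0 0)%N] <=
     (4 * rho ^+ (k.+1 + j))%:E)%E.
Proof.
move=> ha hb ha' hb' E hd.
have [r1 /andP[r1p r1l] C1] := geometric_chernoff ha hd.
have [r2 /andP[r2p r2l] C2] := geometric_chernoff hb hd.
have [r3 /andP[r3p r3l] C3] := geometric_chernoff ha' hd.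
have [r4 /andP[r4p r4l] C4] := geometric_chernoff hb' hd.
pose rho := Num.max (Num.max r1 r2) (Num.max r3 r4).
exists rho; first by rewrite !lt_max !gt_max r1p r1l r2l r3l r4l.
move=> n m k j kn jm hkj; set N := (k.+1 + j)%N.
have le_rho (r : R) : 0 < r -> r <= rho -> ((r ^+ N)%:E <= (rho ^+ N)%:E)%E.
  by move=> r0 rr; rewrite lee_fin; apply: lerXn2r; rewrite ?nnegrE ?(ltW r0)// (le_trans (ltW r0)).
have hs : subunit (@box_parameter R n m a b) := box_parameter_subunit ha hb.
have hs' : subunit (@box_parameter R n m a' b') := box_parameter_subunit ha' hb'.
pose x1 := k%:R * geometric_mean a - delta * N%:R.
pose x2 := j%:R * geometric_mean b - delta * N%:R.
pose x3 := k.+1%:R * geometric_mean a' + delta * N%:R.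
pose x4 := j%:R * geometric_mean b' + delta * N%:R.
have xx : x3 + x4 <= x1 + x2 by rewrite /x1 /x2 /x3 /x4 /N; lra.
pose T1 := [set z : nat | z%:R <= x1].
pose T2 := [set z : nat | z%:R <= x2].
pose T3 := [set z : nat | x3 <= z%:R].
pose T4 := [set z : nat | x4 <= z%:R].
pose A1 := [set f : {ffun box n m -> nat} | T1 (\sum_(0 <= i < k) bottomI f (1 + i))%N].
pose A2 := [set f : {ffun box n m -> nat} | T2 (\sum_(0 <= j' < j) fieldJ f k.+1 j')%N].
pose A3 := [set f : {ffun box n m -> nat} | T3 (\sum_(0 <= i < k.+1) bottomI f (0 + i))%N].
pose A4 := [set f : {ffun box n m -> nat} | T4 (\sum_(0 <= j' < j) fieldJ f k.+1 j')%N].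
have P1 : (config_prob (box_parameter a b) A1 <= (rho ^+ N)%:E)%E.
  apply: le_trans (le_rho r1 r1p _); last by rewrite /rho !le_max lexx.

  rewrite (prob_bottomI ha hb); last by clear -kn; lia.
  by apply: (C1 _ _ _ _).2 => //; rewrite /N; clear; lia.
have P2 : (config_prob (box_parameter a b) A2 <= (rho ^+ N)%:E)%E.
  apply: le_trans (le_rho r2 r2p _); last by rewrite /rho !le_max lexx orbT.
  rewrite (prob_fieldJ ha hb) ?(ltnW kn) ?(ltnW jm)//.
  by apply: (C2 _ _ _ _).2 => //; rewrite /N; clear; lia.
have P3 : (config_prob (box_parameter a' b') A3 <= (rho ^+ N)%:E)%E.
  apply: le_trans (le_rho r3 r3p _); last by rewrite /rho !le_max lexx !orbT.

  rewrite (prob_bottomI ha' hb'); last by clear -kn; lia.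
  by apply: (C3 _ _ _ _).1 => //; rewrite /N; clear; lia.
have P4 : (config_prob (box_parameter a' b') A4 <= (rho ^+ N)%:E)%E.
  apply: le_trans (le_rho r4 r4p _); last by rewrite /rho !le_max lexx !orbT.
  rewrite (prob_fieldJ ha' hb') ?(ltnW kn) ?(ltnW jm)//.
  by apply: (C4 _ _ _ _).1 => //; rewrite /N; clear; lia.
pose A5 := [set f : {ffun box n m -> nat} | x3 + x4 <= (lpp (shift1 (fieldV f)) k j)%:R].
have P5 : (config_prob (box_parameter a b) A5 <= (rho ^+ N + rho ^+ N)%:E)%E.
  rewrite (prob_lpp1_ge _ ha hb ha' hb' E)//.
  apply: le_trans (leeD P3 P4); apply: le_trans (config_probU _ _ hs').
  apply: le_config_prob => // f /= x34; rewrite /A3 /A4 /=.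
  have [|h3] := leP x3 (\sum_(0 <= i < k.+1) bottomI f (0 + i))%N%:R; first by left.
  right; rewrite /T4 /=; move: (height_ge_lpp1 f k j) h3 x34.
  move: (\sum_(0 <= i < _) _)%N (\sum_(0 <= i < _) _)%N (lpp _ _ _) => x y z.
  by rewrite -(ler_nat R) natrD; lra.
rewrite (_ : 4 * _ = rho ^+ N + rho ^+ N + (rho ^+ N + rho ^+ N)); last by ring.
rewrite EFinD; apply: le_trans (leeD (leeD P1 P2) P5).
apply: le_trans (leeD (config_probU _ _ hs) (lexx _)).
apply: le_trans (config_probU _ _ hs).
apply: le_config_prob => // f /=; rewrite fieldH_succ leq_add2r => hH.
have [h1|h1] := leP (\sum_(0 <= i < k) bottomI f (1 + i))%N%:R x1; first by left; left.
have [h2|h2] := leP (\sum_(0 <= j' < j) fieldJ f k.+1 j')%N%:R x2; first by left; right.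
right; rewrite /A5 /=; move: hH h1 h2.
move: (\sum_(0 <= i < _) _)%N (\sum_(0 <= i < _) _)%N (lpp _ _ _) => x y z.
by rewrite -(ler_nat R) natrD; lra.
Qed.

End BoxBound.

Section FarLead.
Context {R : realType}.

(** At some point (k+1, l+1) at distance at least K0, below the line of slope
   s, the passage time from e2 is ahead by at least c of the one from e1. *)
Definition far_lead_in_box (c n K0 : nat) (s : R) (V : nat -> nat -> nat) := exists k l,
  [/\ (k.+1 < n)%N, (l.+1 < n)%N, (K0 <= k.+1)%N, l.+1%:R <= s * k.+1%:R &
      (c + lpp (shift1 V) k l.+1 <= lpp (shift2 V) k.+1 l)%N].

Lemma eq_far_lead_in_box c n K0 s V V' :
  (forall i j, (i < n)%N -> (j < n)%N -> V i j = V' i j) ->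
  far_lead_in_box c n K0 s V -> far_lead_in_box c n K0 s V'.
Proof.
move=> VV' [k [l [kn ln K0k ls h]]]; exists k, l; split=> //.
rewrite -(@eq_lpp (shift1 V) (shift1 V')); last by move=> i j ik jl; apply: VV'; lia.
by rewrite -(@eq_lpp (shift2 V) (shift2 V')) // => i j ik jl; apply: VV'; lia.
Qed.

Lemma geometric_sum_le (x : R) n : 0 < x < 1 -> \sum_(i < n) x ^+ i <= (1 - x)^-1.
Proof.
move=> /andP[x0 x1]; have x1' : 0 < 1 - x by rewrite subr_gt0.
rewrite -(ler_pM2l x1') divff ?gt_eqF//.
have /(congr1 -%R) := subrX1 x n; rewrite -mulNr !opprB => <-.
by rewrite gerBl exprn_ge0 ?ltW.
Qed.

(** By [crossing], a lead of c forces J(0,0) + c <= I(0,0) unless the field is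
    exact somewhere in the sector; the probabilities of the latter form a
    convergent double geometric series. The square root of the rate of
    [prob_exact] leaves one factor for the tail and one for the sum. *)
Lemma prob_far_lead_rate (a b a' b' delta s : R) c K1 :
  0 < a < 1 -> 0 < b < 1 -> 0 < a' < 1 -> 0 < b' < 1 -> a * b = a' * b' ->
  0 < delta <= 1 ->
  (forall k j, (K1 <= k.+1)%N -> j%:R <= s * k.+1%:R ->
    k.+1%:R * geometric_mean a' + j%:R * geometric_mean b' +
      4 * delta * (k.+1 + j)%:R <=
    k%:R * geometric_mean a + j%:R * geometric_mean b) ->
  exists2 rho, 0 < rho < 1 & forall n K0, (0 < n)%N -> (K1 <= K0)%N ->
    (config_prob (fun _ : 'I_n * 'I_n => (a * b)%R)
       [set v | far_lead_in_box c n K0 s (extend v)] <=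
     (a ^+ c * (1 - b) / (1 - a * b) + 4 * rho ^+ K0 / (1 - rho) ^+ 2)%:E)%E.
Proof.
move=> ha hb ha' hb' E hd gap.
have [r /andP[r0 r1] bad] := prob_exact ha hb ha' hb' E hd.
pose rho := Num.sqrt r.
have rho2 : rho ^+ 2 = r by rewrite sqr_sqrtr ?ltW.
have rho0 : 0 < rho by rewrite sqrtr_gt0.
have rho1 : rho < 1 by rewrite -sqrtr1 ltr_sqrt.
exists rho; first by rewrite rho0.
move=> n K0 n0 K10.
have hs : subunit (@box_parameter R n n a b) := box_parameter_subunit ha hb.
rewrite -(prob_fieldV ha hb [set v | far_lead_in_box c n K0 s (extend v)]).
pose I := ('I_n * 'I_n)%type.
pose valid (x : I) := [&& (x.1.+1 < n)%N, (K0 <= x.1.+1)%N & x.2%:R <= s * x.1.+1%:R].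
pose exact (x : I) := [set f : {ffun box n n -> nat} |
  (fieldH f x.1.+1 x.2 <= lpp (shift1 (fieldV f)) x.1 x.2 + fieldI f 0 0)%N].
apply: (@le_trans _ _ (config_prob (box_parameter a b)
    ([set f | (leftJ f 0 + c <= bottomI f 0)%N] `|`
     [set f | exists2 x, valid x & exact x f]))).
  apply: le_config_prob => // f /= h.
  have {h} [k [l [kn ln K0k ls h]]] : far_lead_in_box c n K0 s (fieldV f).
    apply: eq_far_lead_in_box h => i j ni nj.
    by rewrite (extend_ord _ (Ordinal ni) (Ordinal nj)) ffunE.
  have [[x vx ex]|none] := pselect (exists2 x, valid x & exact x f).
    by right; exists x.
  left; have below j : (j <= l)%N ->
      (lpp (shift1 (fieldV f)) k j + fieldI f 0 0 < fieldH f k.+1 j)%N.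
    move=> jl; rewrite ltnNge; apply/negP => hj; apply: none.
    have kn' : (k < n)%N := ltnW kn.
    have jn' : (j < n)%N := leq_ltn_trans jl (ltnW ln).
    exists (Ordinal kn', Ordinal jn') => //; rewrite /valid /= kn K0k /=.
    by apply: le_trans ls; rewrite ler_nat leqW.
  have := crossing below; rewrite -/(fieldV f) -/(fieldI f).
  rewrite -[incJ _ _ _ 0 0]/(leftJ f 0) -[fieldI f 0 0]/(bottomI f 0).
  move: h; move: (lpp _ _ _) (lpp _ _ _) (leftJ _ _) (bottomI _ _); clear; lia.
apply: le_trans (config_probU _ _ hs) _; rewrite EFinD; apply: leeD.
  by rewrite prob_initial_difference.
apply: le_trans (config_prob_bigcup _ _ hs) _.
apply: (@le_trans _ _ (\sum_(x : I) (4 * rho ^+ K0 * (rho ^+ x.1 * rho ^+ x.2))%:E)%E).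
  rewrite big_mkcond /=; apply: lee_sum => -[k j] _; case: ifPn => /=; last first.
    by rewrite lee_fin !mulr_ge0 ?exprn_ge0 ?ltW.
  rewrite /valid /= => /and3P[kn K0k js].
  apply: le_trans (bad n n k j kn (ltn_ord j) _) _; first by apply: gap => //; exact: leq_trans K0k.
  rewrite lee_fin -mulrA ler_pM2l// -rho2 -exprM -!exprD.
  by apply: ler_wiXn2l; rewrite ?ltW//; move: K0k; clear; lia.
rewrite sumEFin lee_fin -mulr_sumr -!mulrA ler_pM2l//.
rewrite ler_pM2l ?exprn_gt0//.
rewrite -(pair_bigA _ (fun i j : 'I_n => rho ^+ i * rho ^+ j)) /=.
under eq_bigr do rewrite -mulr_sumr.
rewrite -mulr_suml expr2 invfM.
by apply: ler_pM; rewrite ?sumr_ge0 ?geometric_sum_le ?rho0// => i _; rewrite exprn_ge0 ?ltW.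
Qed.

(** As a function of a, the mean of the field in the direction (1, s) is
    convex; its minimum is at the parameter whose characteristic slope
    (a - q)^2 / (q (1 - a)^2) is s. The hypothesis places a to the right of
    this minimum. *)
Lemma characteristic_gap (q a s : R) : 0 < q < a -> a < 1 -> 0 < s ->
  s * (q * (1 - a) ^+ 2) < (a - q) ^+ 2 ->
  exists a' : R, [/\ q < a', a' < a &
    geometric_mean a' + s * geometric_mean (q / a') <
    geometric_mean a + s * geometric_mean (q / a)].
Proof.
move=> /andP[q0 qa] a1 s0 slope.
pose h := (a - q) ^+ 2 - s * (q * (1 - a) ^+ 2).
pose C := (a - q) + s * (q * (1 - a)).
have C0 : 0 < C by rewrite addr_gt0 ?subr_gt0// !mulr_gt0// subr_gt0.
have h0 : 0 < h by rewrite subr_gt0.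
pose eta := Num.min ((a - q) / 2) (h / (2 * C)).
have eta0 : 0 < eta.
  by rewrite lt_min !divr_gt0 ?mulr_gt0 ?subr_gt0.
have eta1 : eta <= (a - q) / 2 by rewrite ge_min lexx.
have eta2 : eta * C < h.
  apply: (@le_lt_trans _ _ (h / 2)); last by lra.
  rewrite -ler_pdivlMr// -mulrA -invfM mulrC [2 * C]mulrC.
  by rewrite mulrC ge_min [C * 2]mulrC lexx orbT.
exists (a - eta); split; [lra|lra|].
have mean_dual x : q < x -> geometric_mean (q / x) = q / (x - q).
  move=> qx; rewrite /geometric_mean; field.
  by apply/andP; split; [rewrite subr_eq0 gt_eqF|rewrite gt_eqF// (lt_trans q0)].
rewrite !mean_dual//; last lra.
rewrite /geometric_mean -subr_gt0.
have -> : a / (1 - a) + s * (q / (a - q)) -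
   ((a - eta) / (1 - (a - eta)) + s * (q / (a - eta - q))) =
   eta * (h - eta * C) / ((1 - a) * (1 - (a - eta)) * ((a - q) * (a - eta - q))).
  rewrite /h /C; field.
  by apply/and4P; split; lra.
by rewrite divr_gt0// !mulr_gt0//; lra.
Qed.

End FarLead.

Section FarLeadBound.
Context {R : realType}.

Lemma prob_far_lead_in_box (q a s eps : R) c : 0 < q < a -> a < 1 -> 0 < s ->
  s * (q * (1 - a) ^+ 2) < (a - q) ^+ 2 -> 0 < eps ->
  exists K0, forall n,
    (config_prob (fun _ : 'I_n * 'I_n => q)
       [set v | far_lead_in_box c n K0 s (extend v)] <=
     (a ^+ c * (1 - q / a) / (1 - q) + eps)%:E)%E.
Proof.
move=> qa a1 s0 slope eps0.
have [a' [qa' aa' gap]] := characteristic_gap qa a1 s0 slope.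
have /andP[q0 q1] := qa; have a0 : 0 < a := lt_trans q0 q1.
have a'0 : 0 < a' := lt_trans q0 qa'.
pose b := q / a; pose b' := q / a'.
have b01 : 0 < b < 1 by rewrite divr_gt0// ltr_pdivrMr ?mul1r.
have b'01 : 0 < b' < 1 by rewrite divr_gt0// ltr_pdivrMr ?mul1r.
have abq : a * b = q by rewrite /b mulrC divfK// gt_eqF.
have abq' : a' * b' = q by rewrite /b' mulrC divfK// gt_eqF.
pose al := geometric_mean a; pose al' := geometric_mean a'.
pose be := geometric_mean b; pose be' := geometric_mean b'.
rewrite -/b -/b' -/al -/al' -/be -/be' in gap *.
have bb' : b <= b' by rewrite /b /b' ler_pM2l// lef_pV2 ?posrE// ltW.
have al0 : 0 < al by rewrite /al /geometric_mean divr_gt0 ?subr_gt0.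
have bebe : be <= be'.
  move/andP: b01 b'01 => [? ?] /andP[? ?].
  by rewrite /be /be' /geometric_mean ler_pdivrMr ?subr_gt0// mulrAC ler_pdivlMr ?subr_gt0//; lra.
pose gam := al + s * be - (al' + s * be').
have gam0 : 0 < gam by rewrite subr_gt0.
pose delta := Num.min 1 (gam / (8 * (1 + s))).
have s1 : 0 < 8 * (1 + s) by lra.
have delta0 : 0 < delta <= 1.
  by rewrite lt_min ltr01 divr_gt0//= ge_min lexx.
have delta8 : delta * (8 * (1 + s)) <= gam.
  by rewrite -ler_pdivlMr// ge_min lexx orbT.
have K1P : 2 * al / gam < (Num.bound (2 * al / gam))%:R.
  by apply: archi_boundP; rewrite divr_ge0 ?(ltW gam0)// mulr_ge0 ?(ltW al0).
set K1 := Num.bound _ in K1P.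
have [] := @prob_far_lead_rate R a b a' b' delta s c K1.
- by rewrite a0.
- exact: b01.
- by rewrite a'0 (lt_trans aa').
- exact: b'01.
- by rewrite abq abq'.
- exact: delta0.
- move=> k j Kk js; rewrite -/al -/al' -/be -/be'.
  have hk : 2 * al <= gam * k.+1%:R.
    rewrite -ler_pdivrMl// mulrC ltW// (lt_le_trans K1P)//; by rewrite ler_nat.
  have h1 : j%:R * (be' - be) <= s * k.+1%:R * (be' - be).
    by rewrite ler_wpM2r// subr_ge0.
  have h2 : delta * (k.+1 + j)%:R <= delta * ((1 + s) * k.+1%:R).
    by case/andP: delta0 => d0 _; rewrite ler_pM2l// natrD; lra.
  have h3 : delta * (8 * (1 + s)) * k.+1%:R <= gam * k.+1%:R by rewrite ler_wpM2r.
  move: hk h1 h2 h3; rewrite /gam -[k.+1%:R]natr1.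
  move: (k%:R) (j%:R) ((k.+1 + j)%:R) => x y z; lra.
move=> rho /andP[rho0 rho1] H.
have [K2 K2P] : exists K2, forall K0, (K2 <= K0)%N -> 4 * rho ^+ K0 / (1 - rho) ^+ 2 <= eps.
  have r2 : 0 < (1 - rho) ^+ 2 by rewrite exprn_gt0// subr_gt0.
  have : rho ^+ n @[n --> \oo] --> (0 : R).
    by apply: cvg_expr; rewrite ger0_norm ?ltW.
  move=> /cvgrPdist_lt/(_ (eps * (1 - rho) ^+ 2 / 4)) [].
    by rewrite divr_gt0// mulr_gt0.
  move=> N _ NP; exists N => K0 NK; have := NP K0 NK.
  rewrite /= sub0r normrN ger0_norm ?(exprn_ge0 _ (ltW rho0))// => h.
  by rewrite ler_pdivrMr//; lra.
exists (maxn K1 K2) => n; case: n => [|n].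
  rewrite (_ : [set v | _] = set0) /config_prob ?esum_set0.
    rewrite lee_fin addr_ge0 ?(ltW eps0)// divr_ge0 ?mulr_ge0 ?exprn_ge0 ?subr_ge0//.
    - exact: ltW.
    - by rewrite -/b; case/andP: b01 => _ /ltW.
    - by rewrite ltW// (lt_trans q1).
  by apply/seteqP; split=> // v [k [l []]].
have := H n.+1 (maxn K1 K2) isT (leq_maxl _ _); rewrite abq => /le_trans -> //.
by rewrite lee_fin lerD2l K2P// leq_maxr.
Qed.

End FarLeadBound.

(** * Arrays of independent geometric weights *)

Section GeometricArrays.
Context {R : realType} {d : measure_display} {T : measurableType d}.
Variables (P : probability T R) (q : R).
Implicit Type X : T -> nat -> nat -> nat.

(** The corner of size n of the array is a family of independent geometric
   variables of parameter q, as a random element of a discrete space. *)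
Definition geometric_array X := forall n (A : set {ffun 'I_n * 'I_n -> nat}),
  let E := [set w | A [ffun x : 'I_n * 'I_n => X w x.1 x.2]] in
  measurable E /\ P E = config_prob (fun _ => q) A.

Lemma geometric_array_tr X : 0 < q < 1 -> geometric_array X ->
  geometric_array (fun w i j => X w j i).
Proof.
move=> hq hX n A /=.
pose sw (x : 'I_n * 'I_n) := (x.2, x.1).
have E : [set w | A [ffun x : 'I_n * 'I_n => X w x.2 x.1]] =
    [set w | [set v : {ffun 'I_n * 'I_n -> nat} | A [ffun x => v (sw x)]]
      [ffun x : 'I_n * 'I_n => X w x.1 x.2]].
  suff F w : [ffun x : 'I_n * 'I_n => X w x.2 x.1] = [ffun x : 'I_n * 'I_n =>
      [ffun x : 'I_n * 'I_n => X w x.1 x.2] (sw x)].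
    by apply/seteqP; split=> w /=; rewrite F.
  by apply/ffunP => x; rewrite !ffunE.
rewrite E; have [m ->] := hX n [set v | A [ffun x => v (sw x)]]; split=> //.
rewrite (config_prob_marginal (iota := sw))//.
by move=> [x y] [x' y'] [-> ->].
Qed.

Definition far_lead c K0 s (V : nat -> nat -> nat) := exists k l,
  [/\ (K0 <= k.+1)%N, l.+1%:R <= s * k.+1%:R :> R &
      (c + lpp (shift1 V) k l.+1 <= lpp (shift2 V) k.+1 l)%N].

(** The bound of [prob_far_lead_in_box] does not depend on the size of the box. *)
Lemma prob_far_lead X c (a s eps : R) : geometric_array X ->
  0 < q < a -> a < 1 -> 0 < s ->
  s * (q * (1 - a) ^+ 2) < (a - q) ^+ 2 -> 0 < eps ->
  exists K0, measurable [set w | far_lead c K0 s (X w)] /\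
    (P [set w | far_lead c K0 s (X w)] <=
       (a ^+ c * (1 - q / a) / (1 - q) + eps)%:E)%E.
Proof.
move=> hX qa a1 s0 slope eps0.
have [K0 H] := prob_far_lead_in_box c qa a1 s0 slope eps0.
exists K0; pose F n := [set w | far_lead_in_box c n K0 s (X w)].
have FE n : F n = [set w | [set v | far_lead_in_box c n K0 s (extend v)]
    [ffun x : 'I_n * 'I_n => X w x.1 x.2]].
  by apply/seteqP; split=> w; apply: eq_far_lead_in_box => i j ni nj;
    rewrite (extend_ord _ (Ordinal ni) (Ordinal nj)) ffunE.
have mF n : measurable (F n).
  by rewrite FE; have [] := hX n [set v | far_lead_in_box c n K0 s (extend v)].
have -> : [set w | far_lead c K0 s (X w)] = \bigcup_n F n.
  apply/seteqP; split=> w.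
    move=> [k [l [h1 h2 h3]]]; exists (maxn k l).+2 => //; exists k, l.
    by split=> //; rewrite !ltnS ?leq_maxl ?leq_maxr.
  by move=> [n _ [k [l [_ _ h1 h2 h3]]]]; exists k, l.
have mU : measurable (\bigcup_n F n) by apply: bigcupT_measurable.
split=> //.
have FF : {homo F : n m / (n <= m)%N >-> (n <= m)%O}.
  move=> n m nm; apply/subsetPset => w [k [l [h1 h2 h3 h4 h5]]].
  by exists k, l; split=> //; apply: leq_trans nm.
have cF := @nondecreasing_cvg_mu _ _ _ P F mF mU FF.
rewrite -(cvg_lim _ cF)//; apply: lime_le; first by apply/cvg_ex; exists (P (\bigcup_n F n)).
apply: nearW => n /=; rewrite FE.
by have [_ ->] := hX n [set v | far_lead_in_box c n K0 s (extend v)].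
Qed.

End GeometricArrays.

Section Law.
Context {R : realType} {d : measure_display} {T : measurableType d}.
Variables (P : probability T R) (q : R) (omega : lattice -> {RV P >-> nat}).
Hypotheses (hindep : mutually_independent omega)
  (hgeom : forall (x : lattice) (k : nat), (1 <= k)%N ->
     P [set w | (k <= omega x w)%N] = (q ^+ (k - 1))%:E).

Lemma measurable_omega (x : lattice) (A : set nat) : measurable (omega x @^-1` A).
Proof. by rewrite -[X in measurable X]setTI; apply: measurable_funP. Qed.

Lemma prob_pred (x : lattice) k :
  P (omega x @^-1` [set m | m.-1 = k]) = (geometric_pmf q k)%:E.
Proof.
pose A (j : nat) := omega x @^-1` [set m | (j <= m.-1)%N].
have PA j : P (A j) = (q ^+ j)%:E.
  case: j => [|j].
    by rewrite (_ : A 0%N = setT) ?probability_setT// -subTset.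
  transitivity (q ^+ (j.+2 - 1))%:E; last by rewrite subSS subn0.
  rewrite -(hgeom x)//.
  by congr (P _); apply/seteqP; split=> w; rewrite /A /=; lia.
rewrite (_ : omega x @^-1` _ = A k `\` A k.+1); last first.
  by apply/seteqP; split=> w; rewrite /A /=; [lia|move=> []; lia].
rewrite measureD; last 3 first.
- exact: measurable_omega.
- exact: measurable_omega.
- by apply: le_lt_trans (ltry 1); apply: probability_le1; apply: measurable_omega.
rewrite (_ : A k `&` A k.+1 = A k.+1); last first.
  by apply/setIidPr => w; rewrite /A /=; lia.
transitivity ((q ^+ k)%:E - (q ^+ k.+1)%:E)%E; first by congr (_ - _)%E; exact: PA.
by rewrite -EFinB /geometric_pmf exprS; congr (_%:E); ring.
Qed.

Lemma geometric_array_omega :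
  geometric_array P q (fun w i j => (omega (i%:Z, j%:Z) w).-1).
Proof.
move=> n A /=.
pose box w : {ffun 'I_n * 'I_n -> nat} :=
  [ffun x : 'I_n * 'I_n => (omega (x.1%:Z, x.2%:Z) w).-1].
pose pt (x : 'I_n * 'I_n) : lattice := (x.1%:Z, x.2%:Z).
have inj_pt : injective pt.
  by move=> [x y] [x' y'] [] /val_inj -> /val_inj ->.
pose J : {fset lattice} := [fset pt x | x in {: 'I_n * 'I_n}]%fset.
have atom (g : {ffun 'I_n * 'I_n -> nat}) :
    measurable [set w | box w = g] /\ P [set w | box w = g] = (config_pmf (fun=> q) g)%:E.
  pose B (z : lattice) := [set m : nat | m.-1 = extend g `|z.1| `|z.2|].
  have E : [set w | box w = g] = \bigcap_(z in [set` J]) (omega z @^-1` B z).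
    apply/seteqP; split=> w /=.
      move=> boxg z /= /imfsetP[x _ ->]; rewrite /B /= ?absz_nat extend_ord -boxg.
      by case: x => x y; rewrite ffunE.
    move=> H; apply/ffunP => x; rewrite ffunE.
    have /= := H (pt x); rewrite /B /= ?absz_nat extend_ord => -> //; first by case: x.
    by apply/imfsetP; exists x.
  split.
    rewrite E; apply: fin_bigcap_measurable; first exact: finite_fset.
    by move=> z _; apply: measurable_omega.
  rewrite E hindep// big_imfset /=; last by move=> x y _ _; apply: inj_pt.
  rewrite big_enum /= /config_pmf -prodEFin; apply: eq_bigr => x _.
  rewrite -(prob_pred (pt x)); congr (P (_ @^-1` _)).
  by rewrite /B /= ?absz_nat extend_ord; case: x.
pose F k := [set w | choice.pickle (box w) = k].
have FE g : F (choice.pickle g) = [set w | box w = g].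
  apply/seteqP; split=> w; rewrite /F /=; last by move=> ->.
  exact: (pcan_inj choice.pickleK).
have -> : [set w | A (box w)] = \bigcup_(k in choice.pickle @` A) F k.
  apply/seteqP; split=> w /=; first by move=> Aw; exists (choice.pickle (box w)) => //; exists (box w).
  by move=> [_ [g Ag <-]]; rewrite FE /= => ->.
have mF k : (choice.pickle @` A) k -> measurable (F k).
  by move=> [g Ag <-]; rewrite FE; have [] := atom g.
split; first exact: bigcup_measurable.
rewrite measure_bigcup//; last by move=> i j _ _ [w []]; rewrite /F /= => <- <-.
rewrite nneseries_esum//.
rewrite set_mem_set esum_image; last by move=> x y _ _; apply: (pcan_inj choice.pickleK).
by apply: eq_esum => g _; rewrite FE; exact: (atom g).2.
Qed.

End Law.

(** * From passage times to the interface *)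

Section PassageTimes.
Context {R : realType}.
Import InterfaceFacts.

Definition shifted (x : lattice) (i j : nat) : lattice := (x.1 + i%:Z, x.2 + j%:Z).

Lemma shiftedE x i j : shifted x i j = q x (i + j) i.
Proof. by rewrite /shifted /q; congr pair; lia. Qed.

Lemma lpp_attained V i j : (0 < i + j)%N ->
  (exists2 i', i = i'.+1 & lpp V i j = lpp V i' j + V i' j)%N \/
  (exists2 j', j = j'.+1 & lpp V i j = lpp V i j' + V i j')%N.
Proof.
case: i j => [|i] [|j] //= _.
- by right; exists j; rewrite // big_nat_recr.
- by left; exists i.
case: leqP => _; first by right; exists j.
by left; exists i.
Qed.

Variables (om : lattice -> R) (x : lattice) (V : nat -> nat -> nat).
Hypothesis omV : forall i j, om (shifted x i j) = (V i j)%:R.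

Lemma path_weight_le_lpp i j s : up_right_path x (shifted x i j) s ->
  path_weight om x s <= (lpp V i j)%:R.
Proof.
rewrite shiftedE; move: {2}(i + j)%N (erefl (i + j)%N) => n.
elim: n i j s => [|n IH] i j s nE; rewrite nE => ps.
  by move/size_path : ps => /size0nil ->; rewrite /path_weight big_nil.
have [|k [s' [kn ik -> ps']]] := pathS _ ps; first lia.
have kE : q x n k = shifted x k (n - k) by rewrite shiftedE subnKC.
have /andP[_ /eqP l] := ps'; rewrite weight_rcons l kE omV.
have w : path_weight om x s' <= (lpp V k (n - k))%:R.
  by apply: IH; rewrite ?subnKC.
apply: (@le_trans _ _ (lpp V k (n - k) + V k (n - k))%N%:R).
  by rewrite natrD lerD2r.
rewrite ler_nat; case/orP: ik => /eqP ik.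
  by rewrite ik (_ : j = n - k)%N ?lpp_right //; lia.
by rewrite ik (_ : j = (n - k).+1)%N ?lpp_up //; lia.
Qed.

Lemma lpp_path i j : exists2 s, up_right_path x (shifted x i j) s &
  path_weight om x s = (lpp V i j)%:R.
Proof.
move: {2}(i + j)%N (erefl (i + j)%N) => n.
elim: n i j => [|n IH] i j nE.
  have [-> ->] : i = 0%N /\ j = 0%N by lia.
  exists [::]; last by rewrite /path_weight big_nil /= big_geq.
  by rewrite /up_right_path shiftedE q00 /= eqxx.
have [|[i' iE ->]|[j' jE ->]] := @lpp_attained V i j; first lia.
  have [|s ps sw] := IH i' j; first lia.
  exists (rcons s (shifted x i j)); last first.
    by rewrite weight_rcons sw natrD; have /andP[_ /eqP ->] := ps; rewrite omV.
  have /andP[p /eqP l] := ps.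
  by rewrite /up_right_path rcons_path last_rcons p l eqxx andbT up_rightE /shifted /=; lia.
have [|s ps sw] := IH i j'; first lia.
exists (rcons s (shifted x i j)); last first.
  by rewrite weight_rcons sw natrD; have /andP[_ /eqP ->] := ps; rewrite omV.
have /andP[p /eqP l] := ps.
by rewrite /up_right_path rcons_path last_rcons p l eqxx andbT up_rightE /shifted /=; lia.
Qed.

Lemma passage_time_lpp i j : passage_time om x (shifted x i j) = (lpp V i j)%:R%:E.
Proof.
apply/eqP; rewrite eq_le; apply/andP; split.
  by apply: ge_ereal_sup => _ [s ps <-]; rewrite lee_fin path_weight_le_lpp.
by have [s ps <-] := lpp_path i j; apply: ereal_sup_ubound; exists s.
Qed.

End PassageTimes.

Section InterfaceCriterion.
Context {R : realType}.
Import InterfaceFacts.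
Variables (om : lattice -> R) (V : nat -> nat -> nat).
Hypothesis omV : forall i j, om (i%:Z, j%:Z) = (V i j)%:R.

Lemma Delta_lpp k l : Delta om (k.+1 + l.+1) k.+1 =
  ((lpp (shift2 V) k.+1 l)%:R - (lpp (shift1 V) k l.+1)%:R)%:E.
Proof.
rewrite /Delta.
rewrite [X in passage_time _ e2 X](_ : _ = shifted e2 k.+1 l); last first.
  by rewrite /shifted /e2 /=; congr pair; lia.
rewrite [X in (_ - passage_time _ e1 X)%E](_ : _ = shifted e1 k l.+1); last first.
  by rewrite /shifted /e1 /=; congr pair; lia.
rewrite (@passage_time_lpp _ _ _ (shift2 V)); last first.
  by move=> i j; rewrite /shift2 -omV /shifted /e2 /=; congr (om _); congr pair; lia.
rewrite (@passage_time_lpp _ _ _ (shift1 V))//.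
by move=> i j; rewrite /shift1 -omV /shifted /e1 /=; congr (om _); congr pair; lia.
Qed.

Lemma PD_lpp b k l : PD om b (k.+1 + l.+1) k.+1 =
  (~~ b + lpp (shift1 V) k l.+1 <= lpp (shift2 V) k.+1 l)%N.
Proof.
rewrite /PD Delta_lpp; case: b; rewrite ?lee_fin ?lte_fin.
  by rewrite subr_ge0 ler_nat.
by rewrite subr_gt0 ltr_nat.
Qed.

End InterfaceCriterion.

Section InterfaceDependence.
Context {R : realType}.
Import InterfaceFacts.

Lemma eq_PD (om om' : lattice -> R) (V V' : nat -> nat -> nat) b n :
  (forall i j, om (i%:Z, j%:Z) = (V i j)%:R) ->
  (forall i j, om' (i%:Z, j%:Z) = (V' i j)%:R) ->
  (forall i j, (i <= n.+1)%N -> (j <= n.+1)%N -> V i j = V' i j) ->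
  forall i, (i <= n.+1)%N -> PD om b n.+1 i = PD om' b n.+1 i.
Proof.
move=> omV omV' VV' i ni.
case: i ni => [|i] ni; first by rewrite !PDc// !c0.
have [->|ne] := eqVneq i n; first by rewrite !PDc// !cN.
have -> : n.+1 = (i.+1 + (n - i).-1.+1)%N by lia.
rewrite (PD_lpp omV) (PD_lpp omV'); congr (_ + _ <= _)%N; apply: eq_lpp => j k ? ?;
  by apply: VV'; lia.
Qed.

(** The signs are monotone along an antidiagonal, so that they determine where the
    interface crosses it. *)
Lemma eq_explicit_interface (om om' : lattice -> R) b phi phi' n :
  explicit_interface om b phi -> explicit_interface om' b phi' ->
  (forall i, (i <= n.+1)%N -> PD om b n.+1 i = PD om' b n.+1 i) ->
  phi n = phi' n.
Proof.
move=> H H' E.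
have [k [kn a b1 ->]] := H n; have [k' [kn' a' b' ->]] := H' n.
rewrite -!E // in a' b'; last lia.
rewrite !PDc // in a b1 a' b'; try lia.
suff -> : k = k' by [].
apply/eqP; rewrite eqn_leq; apply/andP; split; rewrite leqNgt; apply/negP => h.
  by move/negP: b'; apply; apply: (c_mono _ _ a); lia.
by move/negP: b1; apply; apply: (c_mono _ _ a'); lia.
Qed.

End InterfaceDependence.

Section InterfaceFraction.
Context {R : realType}.
Import InterfaceFacts.

(** The two coordinates of [phi n] add up to n + 1. *)
Definition fraction (phi : nat -> R * R) n : R := (phi n).2 / n.+1%:R.

Lemma explicit_interface_sum (om : lattice -> R) b phi n : explicit_interface om b phi ->
  (phi n).1 = n.+1%:R - (phi n).2.
Proof.
move=> H; have [k [kn _ _ ->]] := H n; rewrite /= natrB ?(ltnW kn)//; ring.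
Qed.

Lemma fraction_gt0_lt1 (om : lattice -> R) b phi n : explicit_interface om b phi ->
  0 < fraction phi n < 1.
Proof.
move=> H; have [k [kn _ _ E]] := H n; rewrite /fraction E /=.
rewrite divr_gt0 ?ltr0n//=; last first.
  have : (1%:R : R) <= (n.+1 - k)%:R by rewrite ler_nat subn_gt0.
  lra.
rewrite ltr_pdivrMr ?ltr0n// mul1r.
have : ((n.+1 - k)%:R : R) <= n.+1%:R by rewrite ler_nat leq_subr.
lra.
Qed.

(** The half-integer offset of the interface is absorbed by a change of slope,
    from f / (1 - f) to s. *)
Lemma sector_threshold (f s : R) K0 : 0 < f < 1 -> f < s * (1 - f) ->
  exists N, forall m k l, (N <= m)%N -> (k + l = m)%N -> l%:R <= f * m%:R + 2^-1 ->
    (K0 < k)%N /\ l%:R <= s * k%:R.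
Proof.
move=> /andP[f0 f1] fs.
pose x := (K0%:R + 2) / (1 - f) + (1 + s) / (s * (1 - f) - f).
have s0 : 0 < s by have : 0 < s * (1 - f) by [lra]; rewrite pmulr_lgt0 ?subr_gt0.
have x1 : 0 <= (K0%:R + 2) / (1 - f) by rewrite divr_ge0 ?subr_ge0 ?ltW// addr_gt0.
have x2 : 0 <= (1 + s) / (s * (1 - f) - f) by rewrite divr_ge0 ?subr_ge0 ?ltW// addr_gt0.
exists (Num.bound x) => m k l xm klm hl.
have mx : x < m%:R.
  by apply: lt_le_trans (archi_boundP _) _; rewrite ?addr_ge0// ler_nat.
have kE : k%:R = m%:R - l%:R :> R by rewrite -klm natrD addrK.
have m1 : K0%:R + 2 < m%:R * (1 - f).
  by rewrite -ltr_pdivrMr ?subr_gt0// (le_lt_trans _ mx)// lerDl.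
have m2 : 1 + s < m%:R * (s * (1 - f) - f).
  by rewrite -ltr_pdivrMr ?subr_gt0// (le_lt_trans _ mx)// lerDr.
split.
  by rewrite -(ltr_nat R) kE; lra.
rewrite kE; move: hl m2 s0; move: (m%:R) (l%:R) => M L hl m2 s0.
have : s * L <= s * (f * M + 2^-1) by rewrite ler_pM2l.
lra.
Qed.

Variables (om : lattice -> R) (X : nat -> nat -> nat) (b : bool) (phi : nat -> R * R).
Hypotheses (omX : forall i j, om (i%:Z, j%:Z) = (X i j).+1%:R)
  (hphi : explicit_interface om b phi).

Lemma PD_pred k l : PD om b (k.+1 + l.+1) k.+1 =
  (~~ b + lpp (shift1 X) k l.+1 <= lpp (shift2 X) k.+1 l)%N.
Proof.
rewrite (PD_lpp (V := fun i j => (X i j).+1) omX).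
by rewrite (lpp_succ (shift1 X)) (lpp_succ (shift2 X)); lia.
Qed.

Lemma far_lead_of_fraction_le (f s : R) K0 N n :
  (forall m k l, (N <= m)%N -> (k + l = m)%N -> l%:R <= f * m%:R + 2^-1 ->
    (K0 < k)%N /\ l%:R <= s * k%:R) ->
  (N <= n)%N -> fraction phi n <= f -> far_lead (~~ b) K0 s X.
Proof.
move=> HN Nn; have [k [kn Pk _ E]] := hphi n.
rewrite /fraction E /= ler_pdivrMr ?ltr0n// => hf.
have [|||k0 ls] := HN n.+1 k (n.+1 - k)%N; [lia|lia|lra|].
case: k kn Pk E hf k0 ls => // k kn Pk _ _ k0 ls.
exists k, (n.+1 - k.+2)%N.
have lE : ((n.+1 - k.+2).+1 = n.+1 - k.+1)%N by lia.
split; [lia|by rewrite lE|].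
by rewrite -PD_pred (_ : (k.+1 + _ = n.+1)%N)//; lia.
Qed.

(** Not leading by c, for c = 0 or 1, means that the other point leads by
    1 - c, which is [b] as a number. *)
Lemma far_lead_of_fraction_ge (f s : R) K0 N n :
  (forall m k l, (N <= m)%N -> (k + l = m)%N -> l%:R <= (1 - f) * m%:R + 2^-1 ->
    (K0 < k)%N /\ l%:R <= s * k%:R) ->
  (N <= n)%N -> f <= fraction phi n -> far_lead b K0 s (fun i j => X j i).
Proof.
move=> HN Nn; have [k [kn _ Pk E]] := hphi n.
rewrite /fraction E /= ler_pdivlMr ?ltr0n// => hf.
have kE : (n.+1 - k)%:R = n.+1%:R - k%:R :> R by rewrite natrB// ltnW.
have [|||l0 ls] := HN n.+1 (n - k)%N k.+1; [lia|lia| |].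
  by move: hf; rewrite kE -(natr1 k); lra.
have lE : ((n - k).-1.+1 = n - k)%N by lia.
exists (n - k).-1, k; rewrite lE; split; [exact: ltnW|by []|].
rewrite (lpp_tr (shift2 X)) (lpp_tr (shift1 X) (n - k)) -lE.
move: Pk; rewrite (_ : n.+1 = k.+1 + (n - k).-1.+1)%N; last lia.
rewrite PD_pred -[(n - k).-1.+1.-1]/(n - k).-1.
by move: (lpp _ _ _) (lpp _ _ _) => x y; case: (b); lia.
Qed.

End InterfaceFraction.

(** * Convergence from bounds on the tails *)

Section LimitFromTails.
Context {R : realType} {d : measure_display} {T : measurableType d}.
Variables (P : probability T R) (y : nat -> T -> R) (F : R -> R).
Hypotheses (my : forall n, measurable_fun setT (y n))
  (y01 : forall n w, 0 < y n w < 1).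

Let below f N := [set w | exists2 n, (N <= n)%N & y n w <= f].
Let above f N := [set w | exists2 n, (N <= n)%N & f <= y n w].

Hypotheses (tail_below : forall f eps, 0 < f < 1 -> 0 < eps ->
     exists N, (P (below f N) <= (F f + eps)%:E)%E)
  (tail_above : forall f eps, 0 < f < 1 -> 0 < eps ->
     exists N, (P (above f N) <= (1 - F f + eps)%:E)%E)
  (contF : forall f, 0 <= f < 1 -> {for f, continuous F}) (F0 : F 0 = 0).

Let measurable_le n f : measurable [set w | y n w <= f].
Proof.
rewrite (_ : [set w | _] = y n @^-1` `]-oo, f]); last first.
  by apply/seteqP; split=> w /=; rewrite in_itv.
by rewrite -[X in measurable X]setTI; apply: my.
Qed.

Let measurable_ge n f : measurable [set w | f <= y n w].
Proof.
rewrite (_ : [set w | _] = y n @^-1` `[f, +oo[); last first.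
  by apply/seteqP; split=> w /=; rewrite in_itv /= andbT.
by rewrite -[X in measurable X]setTI; apply: my.
Qed.

Let measurable_below f N : measurable (below f N).
Proof.
rewrite (_ : below f N = \bigcup_(n in [set n | (N <= n)%N]) [set w | y n w <= f]).
  by apply: bigcup_measurable.
by apply/seteqP; split=> w [n Nn h]; exists n.
Qed.

Let measurable_above f N : measurable (above f N).
Proof.
rewrite (_ : above f N = \bigcup_(n in [set n | (N <= n)%N]) [set w | f <= y n w]).
  by apply: bigcup_measurable.
by apply/seteqP; split=> w [n Nn h]; exists n.
Qed.

Let io_below f := \bigcap_N below f N.
Let io_above f := \bigcap_N above f N.

Let measurable_io_below f : measurable (io_below f).
Proof. exact: bigcapT_measurable. Qed.

Let measurable_io_above f : measurable (io_above f).
Proof. exact: bigcapT_measurable. Qed.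

Let prob_io_below f : 0 < f < 1 -> (P (io_below f) <= (F f)%:E)%E.
Proof.
move=> hf; apply/lee_addgt0Pr => eps eps0.
have [N H] := tail_below hf eps0; rewrite -EFinD; apply: le_trans H.
by apply: le_measure; rewrite ?inE//; apply: bigcap_inf.
Qed.

Let prob_io_above f : 0 < f < 1 -> (P (io_above f) <= (1 - F f)%:E)%E.
Proof.
move=> hf; apply/lee_addgt0Pr => eps eps0.
have [N H] := tail_above hf eps0; rewrite -EFinD; apply: le_trans H.
by apply: le_measure; rewrite ?inE//; apply: bigcap_inf.
Qed.

Let io_cover f : ~` io_below f `<=` io_above f.
Proof.
move=> w nb N _; have [M _ hM] : exists2 M, True & ~ below f M w.
  apply: contrapT => H; apply: nb => M _; apply: contrapT => nM.
  by apply: H; exists M.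
exists (maxn N M); rewrite ?leq_maxl//; rewrite leNgt; apply/negP => /ltW h.
by apply: hM; exists (maxn N M); rewrite ?leq_maxr.
Qed.

Let prob_io_both f : 0 < f < 1 -> P (io_above f `&` io_below f) = 0%E.
Proof.
move=> hf; have fin A : measurable A -> P A \is a fin_num by move=> mA; apply: fin_num_measure.
have E : P (io_above f) = (P (io_above f `\` io_below f) + P (io_above f `&` io_below f))%E.
  exact: measureDI.
rewrite (_ : io_above f `\` io_below f = ~` io_below f) in E; last first.
  by apply/seteqP; split=> [w []//|w nw]; split=> //; apply: io_cover.
rewrite probability_setC// in E.
have := prob_io_above hf; have := prob_io_below hf; rewrite E.
have : (0 <= P (io_above f `&` io_below f))%E by apply: measure_ge0.
have : P (io_below f) \is a fin_num by apply: fin.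
have : P (io_above f `&` io_below f) \is a fin_num by apply: fin; apply: measurableI.
move: (P (io_below f)) (P (_ `&` _)) => [p||] [z||] //= _ _.
rewrite -EFinB -EFinD !lee_fin => z0 h1 h2; congr (_%:E).
by apply/eqP; rewrite eq_le z0 andbT; lra.
Qed.

Let oscillating := \bigcup_(r : rat)
  [set w | 0 < (ratr r : R) < 1 /\ (io_above (ratr r) `&` io_below (ratr r)) w].

Let oscillating_neg : measurable oscillating /\ P oscillating = 0%E.
Proof.
have piece (r : rat) : measurable [set w | 0 < (ratr r : R) < 1 /\
    (io_above (ratr r) `&` io_below (ratr r)) w] /\
    P [set w | 0 < (ratr r : R) < 1 /\ (io_above (ratr r) `&` io_below (ratr r)) w] = 0%E.
  case: (boolP (0 < (ratr r : R) < 1)) => hr.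
    rewrite (_ : [set w | _] = io_above (ratr r) `&` io_below (ratr r)).
      by split; [exact: measurableI|exact: prob_io_both].
    by apply/seteqP; split=> [w []|w].
  rewrite (_ : [set w | _] = set0) ?measure0//.
  by apply/seteqP; split=> [w []|w].
have m : measurable oscillating.
  by apply: bigcupT_measurable_rat => r; have [] := piece r.
split=> //.
have : P.-negligible oscillating.
  rewrite /oscillating (_ : \bigcup_r _ = \bigcup_(k : nat) (if choice.unpickle k is Some r then
     [set w | 0 < (ratr r : R) < 1 /\ (io_above (ratr r) `&` io_below (ratr r)) w] else set0)).
    apply: negligible_bigcup => k; case: choice.unpickle => [r|]; last exact: negligible_set0.
    by have [mr pr] := piece r; apply/negligibleP.
  apply/seteqP; split=> [w [r _ hr]|w [k _]]; first by exists (choice.pickle r); rewrite ?choice.pickleK.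
  by case: choice.unpickle => // r hr; exists r.
by move=> h; apply/negligibleP.
Qed.

Let bounded_y w : bounded_fun (fun n => y n w).
Proof.
exists 1; split=> // M M1 n _ /=; have /andP[? ?] := y01 n w.
by rewrite ger0_norm ?ltW// (lt_trans _ M1).
Qed.

Let cvg_y w : ~ oscillating w -> cvgn (fun n => y n w).
Proof.
move=> now.
pose S := [set f | exists N, forall n, (N <= n)%N -> f < y n w].
have S0 : S 0 by exists 0%N => n _; have /andP[] := y01 n w.
have S1 f : S f -> f < 1.
  by move=> [N /(_ N (leqnn N)) h]; have /andP[_ h'] := y01 N w; apply: lt_trans h'.
have supS : has_sup S by split; [exists 0|exists 1 => f /S1 /ltW].
apply/cvg_ex; exists (sup S); apply/cvgrPdist_lt => eps eps0.
have [f [N fN] fS] := sup_adherent eps0 supS.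
have [M HM] : exists M, forall n, (M <= n)%N -> y n w < sup S + eps.
  have [|r] := @rat_in_itvoo R (sup S) (sup S + eps); first by rewrite ltrDl.
  rewrite in_itv /= => /andP[Sr rS].
  have nS : ~ S (ratr r) by move=> /(ub_le_sup supS.2); rewrite leNgt Sr.
  have [r1|r1] := leP 1 (ratr r : R).
    by exists 0%N => n _; have /andP[_ h] := y01 n w; apply: lt_trans h _; apply: le_lt_trans rS.
  have r01 : 0 < (ratr r : R) < 1.
    by rewrite r1 andbT (le_lt_trans _ Sr)//; apply: ub_le_sup supS.2 _ S0.
  have iob : io_below (ratr r) w.
    move=> N' _; apply: contrapT => nb; apply: nS; exists N' => n N'n.
    by rewrite ltNge; apply/negP => h; apply: nb; exists n.
  have [M hM] : exists M, ~ above (ratr r) M w.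
    apply: contrapT => H; apply: now; exists r => //; split=> //; split=> // M _.
    by apply: contrapT => nM; apply: H; exists M.
  exists M => n Mn; apply: lt_trans rS; rewrite ltNge; apply/negP => h.
  by apply: hM; exists n.
exists (maxn N M) => // n; rewrite /= geq_max => /andP[Nn Mn].
have h1 := fN n Nn; have h2 := HM n Mn.
by rewrite ltr_distlC; apply/andP; split; lra.
Qed.

(** Almost surely, no rational f in (0, 1) has both y_n <= f and y_n >= f
    infinitely often: these two events cover the space and their probabilities
    add up to at most 1. So y_n converges, and its limit is at most f
    only if y_n <= g infinitely often for all g > f, and above f only if
    y_n >= f infinitely often. *)
Lemma cvg_of_tail_bounds : exists Y : {RV P >-> R},
  [/\ forall w, 0 <= Y w <= 1,
      {ae P, forall w, y ^~ w @ \oo --> Y w} &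
      forall f, 0 <= f < 1 -> P [set w | (Y w <= f)%R] = (F f)%:E].
Proof.
pose L w := limn_sup (fun n => y n w).
have mL : measurable_fun setT L.
  apply: measurable_realfun.measurable_fun_limn_sup => // w _.
    by exists 1 => _ [n _ <-]; have /andP[_ /ltW] := y01 n w.
  by exists 0 => _ [n _ <-]; have /andP[/ltW] := y01 n w.
(* The clipping gives the bounds also where the sequence diverges. *)
pose Y w := Num.min (Num.max (L w) 0) 1.
have mY : measurable_fun setT Y.
  apply: measurable_realfun.measurable_minr => //.
  exact: measurable_realfun.measurable_maxr.
have cY w : ~ oscillating w -> y ^~ w @ \oo --> Y w.
  move=> /cvg_y c; have LE : L w = limn (y ^~ w) by apply: (cvg_limn_supE c).
  have l0 : 0 <= limn (y ^~ w).
    by apply: limr_ge c _; apply: nearW => n; have /andP[/ltW] := y01 n w.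
  have l1 : limn (y ^~ w) <= 1.
    by apply: limr_le c _; apply: nearW => n; have /andP[_ /ltW] := y01 n w.
  by rewrite /Y LE max_l// min_l.
have Y01 w : 0 <= Y w <= 1.
  by rewrite /Y le_min le_max lexx orbT ler01/= ge_min lexx orbT.
have [mo po] := oscillating_neg.
have mYle f : measurable [set w | Y w <= f].
  rewrite (_ : [set w | _] = Y @^-1` `]-oo, f]); last first.
    by apply/seteqP; split=> w /=; rewrite in_itv.
  by rewrite -[X in measurable X]setTI; apply: mY.
have addnull A : measurable A -> (P (A `|` oscillating) <= P A)%E.
  by move=> mA; rewrite -[leRHS]adde0 -po; apply: measureU2.
have up f g : f < g -> 0 < g < 1 -> (P [set w | (Y w <= f)%R] <= (F g)%:E)%E.
  move=> fg hg; apply: (@le_trans _ _ (P (io_below g `|` oscillating))).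
    apply: le_measure; rewrite ?inE//; first exact: measurableU.
    move=> w /= Yf; have [hosc|no] := pselect (oscillating w); [by right|left].
    have /cvgrPdist_lt/(_ (g - Y w)) [] := cY w no.
      by rewrite subr_gt0 (le_lt_trans Yf).
    move=> N _ HN M _; exists (maxn N M); rewrite ?leq_maxr//.
    have := HN (maxn N M) (leq_maxl _ _); rewrite /= ltr_distlC => /andP[_]; lra.
  by apply: le_trans (addnull _ _) (prob_io_below hg).
have low f : 0 < f < 1 -> ((F f)%:E <= P [set w | (Y w <= f)%R])%E.
  move=> hf; have : (P (~` [set w | (Y w <= f)%R]) <= (1 - F f)%:E)%E.
    apply: (@le_trans _ _ (P (io_above f `|` oscillating))).
      apply: le_measure; rewrite ?inE//; [exact: measurableC|exact: measurableU|].
      move=> w /= /negP; rewrite -ltNge => fY.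
      have [hosc|no] := pselect (oscillating w); [by right|left].
      have /cvgrPdist_lt/(_ (Y w - f)) [] := cY w no; first by rewrite subr_gt0.
      move=> N _ HN M _; exists (maxn N M); rewrite ?leq_maxr//.
      have := HN (maxn N M) (leq_maxl _ _); rewrite /= ltr_distlC => /andP[+ _]; lra.
    by apply: le_trans (addnull _ _) (prob_io_above hf).
  rewrite probability_setC//.
  have : P [set w | (Y w <= f)%R] \is a fin_num by apply: fin_num_measure.
  move: (P _) => [p||] //= _.
  by rewrite -EFinB !lee_fin; lra.
have right_limit f : 0 <= f < 1 -> (P [set w | (Y w <= f)%R] <= (F f)%:E)%E.
  move=> hf; have /andP[f0 f1] := hf; apply/lee_addgt0Pr => eps eps0.
  have /cvgrPdist_lt/(_ eps eps0) := contF hf.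
  rewrite near_simpl => /nbhs_ballP[del /= del0 H].
  pose g := Num.min (f + del / 2) ((f + 1) / 2).
  have fg : f < g by rewrite lt_min; apply/andP; split; lra.
  have g1 : g < 1 by rewrite /g gt_min (_ : (f + 1) / 2 < 1) ?orbT//; lra.
  have gd : g < f + del by rewrite /g gt_min (_ : f + del / 2 < f + del)//; lra.
  have /H /= : ball f del g by rewrite /ball /= ltr_distlC; apply/andP; split; lra.
  rewrite ltr_distlC => /andP[_ h].
  apply: le_trans (up f g fg _) _; first by rewrite g1 (le_lt_trans f0 fg).
  by rewrite -EFinD lee_fin ltW.
exists (HB.pack_for {RV P >-> R} Y (isMeasurableFun.Build _ _ _ _ Y mY)).
split=> //=.
  by exists oscillating; split=> // w /= h; apply: contrapT => /cY.
move=> f hf; apply/eqP; rewrite eq_le right_limit//=.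
have [->|fn0] := eqVneq f 0; first by rewrite F0 measure_ge0.
by apply: low; have /andP[f0 ->] := hf; rewrite lt_neqAle eq_sym fn0 f0.
Qed.

End LimitFromTails.

(** * The limiting law *)

Section LimitingLaw.
Context {R : realType}.

(** The distribution function of the asymptotic share of vertical steps, for leftmost
   ([c] false) and rightmost ([c] true) geodesics. *)
Definition limit_cdf (q : R) (c : bool) (f : R) : R :=
  Num.sqrt (q * f) /
    ((if c then 1 else q) * Num.sqrt (1 - f) + Num.sqrt (q * f)).

Variable q : R.
Hypothesis hq : 0 < q < 1.

Lemma limit_cdf_denominator_gt0 c f : 0 <= f < 1 ->
  0 < (if c then 1 else q) * Num.sqrt (1 - f) + Num.sqrt (q * f).
Proof.
move=> /andP[f0 f1]; have /andP[q0 _] := hq.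
apply: ltr_wpDr; first exact: sqrtr_ge0.
by rewrite mulr_gt0 ?sqrtr_gt0 ?subr_gt0//; case: c.
Qed.

Lemma limit_cdf0 c : limit_cdf q c 0 = 0.
Proof. by rewrite /limit_cdf mulr0 sqrtr0 mul0r. Qed.

Lemma limit_cdf_dual c f : 0 < f < 1 ->
  limit_cdf q (~~ c) (1 - f) = 1 - limit_cdf q c f.
Proof.
move=> /andP[f0 f1]; have /andP[q0 _] := hq.
rewrite /limit_cdf subKr !sqrtrM ?(ltW q0)//.
have u0 : 0 < Num.sqrt (1 - f) by rewrite sqrtr_gt0 subr_gt0.
have v0 : 0 < Num.sqrt f by rewrite sqrtr_gt0.
have r0 : 0 < Num.sqrt q by rewrite sqrtr_gt0.
have qE : q = Num.sqrt q ^+ 2 by rewrite sqr_sqrtr ?ltW.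
move: (Num.sqrt (1 - f)) (Num.sqrt f) (Num.sqrt q) u0 v0 r0 qE => u v r u0 v0 r0 ->.
case: c => /=; field; apply/andP; split; rewrite gt_eqF// ?addr_gt0 ?mulr_gt0 ?exprn_gt0//.
Qed.

Lemma continuous_limit_cdf c f : 0 <= f < 1 -> {for f, continuous (limit_cdf q c)}.
Proof.
move=> hf; have cs : {for f, continuous (fun x => Num.sqrt (q * x))}.
  apply: (@continuous_comp _ _ _ (fun x => q * x)); last exact: sqrt_continuous.
  by apply: continuousM; [exact: cvg_cst|exact: cvg_id].
have cu : {for f, continuous (fun x : R => Num.sqrt (1 - x))}.
  apply: (@continuous_comp R R R (fun x : R => 1 - x)); last exact: sqrt_continuous.
  by apply: (@continuousB R R R (cst 1) id); [exact: cvg_cst|exact: cvg_id].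
apply: continuousM => //; apply: continuousV.
  by rewrite gt_eqF// limit_cdf_denominator_gt0.
apply: continuousD => //; apply: continuousM; first exact: cvg_cst.
exact: cu.
Qed.

(** [limit_cdf] is the probability of J + c <= I at the parameter a0 whose
    characteristic slope is f / (1 - f); a slightly larger parameter a has a
    larger slope, and s is chosen between the two. *)
Lemma limit_cdf_approx (c : bool) f eps : 0 < f < 1 -> 0 < eps ->
  exists a s, [/\ q < a < 1, 0 < s, f < s * (1 - f),
    s * (q * (1 - a) ^+ 2) < (a - q) ^+ 2 &
    a ^+ c * (1 - q / a) / (1 - q) <= limit_cdf q c f + eps].
Proof.
move=> /andP[f0 f1] eps0; have /andP[q0 q1] := hq.
pose u := Num.sqrt (1 - f); pose v := Num.sqrt (q * f).
have u0 : 0 < u by rewrite sqrtr_gt0 subr_gt0.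
have v0 : 0 < v by rewrite sqrtr_gt0 mulr_gt0.
have uE : u ^+ 2 = 1 - f by rewrite sqr_sqrtr// subr_ge0 ltW.
have vE : v ^+ 2 = q * f by rewrite sqr_sqrtr// mulr_ge0 ?(ltW q0) ?(ltW f0).
pose a0 := (q * u + v) / (u + v).
have uv0 : 0 < u + v by rewrite addr_gt0.
have uv1 : u + v != 0 by rewrite gt_eqF.
have a0q : a0 - q = (1 - q) * v / (u + v) by rewrite /a0; field.
have a01 : 1 - a0 = (1 - q) * u / (u + v) by rewrite /a0; field.
have qa0 : q < a0 by rewrite -subr_gt0 a0q !divr_gt0 ?mulr_gt0 ?subr_gt0.
have a0l1 : a0 < 1 by rewrite -subr_gt0 a01 !divr_gt0 ?mulr_gt0 ?subr_gt0.
pose eta := Num.min ((1 - a0) / 2) (eps * (q * (1 - q))).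
have e0 : 0 < eta by rewrite lt_min !mulr_gt0 ?subr_gt0.
have e1 : eta <= (1 - a0) / 2 by rewrite ge_min lexx.
have e2' : eta <= eps * (q * (1 - q)) by rewrite ge_min lexx orbT.
pose a := a0 + eta.
have qa : q < a by rewrite /a; lra.
have a1 : a < 1 by rewrite /a; lra.
have char : (1 - f) * (a0 - q) ^+ 2 = f * (q * (1 - a0) ^+ 2).
  rewrite a0q a01 -uE !exprMn vE; ring.
have m1 : (a0 - q) ^+ 2 < (a - q) ^+ 2.
  by rewrite ltr_pXn2r ?nnegrE ?subr_ge0 ?(ltW qa) ?(ltW qa0)// /a; lra.
have m2 : (1 - a) ^+ 2 <= (1 - a0) ^+ 2.
  by rewrite ler_pXn2r ?nnegrE ?subr_ge0 ?(ltW a1) ?(ltW a0l1)// /a; lra.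
have d1 : 0 < q * (1 - a) ^+ 2 by rewrite mulr_gt0 ?exprn_gt0 ?subr_gt0.
have strict : f * (q * (1 - a) ^+ 2) < (1 - f) * (a - q) ^+ 2.
  apply: (@le_lt_trans _ _ (f * (q * (1 - a0) ^+ 2))).
    by rewrite !ler_pM2l.
  by rewrite -char ltr_pM2l// subr_gt0.
have slopes : f / (1 - f) < (a - q) ^+ 2 / (q * (1 - a) ^+ 2).
  by rewrite ltr_pdivrMr ?subr_gt0// mulrAC ltr_pdivlMr// [ltRHS]mulrC.
pose s := (f / (1 - f) + (a - q) ^+ 2 / (q * (1 - a) ^+ 2)) / 2.
have s1 : f / (1 - f) < s by rewrite /s; lra.
have s2 : s < (a - q) ^+ 2 / (q * (1 - a) ^+ 2) by rewrite /s; lra.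
exists a, s; split=> //.
- by rewrite qa.
- by apply: lt_trans s1; rewrite divr_gt0 ?subr_gt0.
- by rewrite -ltr_pdivrMr ?subr_gt0.
- by rewrite -ltr_pdivlMr.
have cdfE : limit_cdf q c f = a0 ^+ c * (1 - q / a0) / (1 - q).
  have w0 : 0 < q * u + v by rewrite addr_gt0 ?mulr_gt0.
  rewrite /limit_cdf -/u -/v /a0; case: (c); rewrite ?expr1 ?expr0 ?mul1r; field.
    by rewrite uv1 subr_eq0 !gt_eqF.
  by rewrite uv1 subr_eq0 !gt_eqF.
rewrite cdfE -lerBlDl -mulrBl ler_pdivrMr ?subr_gt0//.
have a0gt : 0 < a0 := lt_trans q0 qa0.
have agt : 0 < a := lt_trans q0 qa.
have inc : a ^+ c * (1 - q / a) - a0 ^+ c * (1 - q / a0) <= eta / q.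
  case: (c); rewrite ?expr1 ?expr0 ?mul1r.
    have -> : a * (1 - q / a) - a0 * (1 - q / a0) = eta.
      by rewrite /a; field; rewrite !gt_eqF.
    by rewrite ler_pdivlMr// ler_piMr// ltW.
  have -> : 1 - q / a - (1 - q / a0) = eta * (q / (a * a0)).
    by rewrite /a; field; rewrite !gt_eqF.
  rewrite ler_pM2l// ler_pdivrMr; last exact: mulr_gt0.
  rewrite ler_pdivlMl//.
  by apply: ler_pM; rewrite ?ltW.
apply: le_trans inc _; rewrite ler_pdivrMr//.
by apply: le_trans e2' _; rewrite -!mulrA (mulrC q).
Qed.

Lemma limit_cdf_angle c t : 0 <= t < pi / 2 ->
  0 <= sin t / (sin t + cos t) < 1 /\
  limit_cdf q c (sin t / (sin t + cos t)) = Num.sqrt (q * sin t) /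
    ((if c then 1 else q) * Num.sqrt (cos t) + Num.sqrt (q * sin t)).
Proof.
move=> /andP[t0 t1]; have /andP[q0 _] := hq.
have pi0 := pi_gt0 R.
have s0 : 0 <= sin t by apply: sin_ge0_pi; rewrite t0 /=; lra.
have c0 : 0 < cos t by apply: cos_gt0_pihalf; apply/andP; split; lra.
have sc0 : 0 < sin t + cos t by rewrite ltr_wpDl.
split.
  by rewrite divr_ge0 ?(ltW sc0)//= ltr_pdivrMr// mul1r ltrDl.
have E1 : 1 - sin t / (sin t + cos t) = cos t / (sin t + cos t).
  by field; rewrite gt_eqF.
have r0 : 0 < Num.sqrt (sin t + cos t) by rewrite sqrtr_gt0.
have quot x : 0 <= x -> Num.sqrt (x / (sin t + cos t)) =
    Num.sqrt x / Num.sqrt (sin t + cos t).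
  by move=> x0; rewrite sqrtrM// sqrtrV// ltW.
rewrite /limit_cdf E1 mulrA !quot ?mulr_ge0 ?(ltW q0) ?(ltW c0)//.
have u0 : 0 < Num.sqrt (cos t) by rewrite sqrtr_gt0.
have v0 : 0 <= Num.sqrt (q * sin t) by exact: sqrtr_ge0.
move: (Num.sqrt (cos t)) (Num.sqrt (q * sin t)) (Num.sqrt (sin t + cos t)) u0 v0 r0 => u v r u0 v0 r0.
have k0 : 0 < (if c then 1 else q) by case: c.
move: (if c then 1 else q) k0 => k k0; field.
have ku : 0 < k * u + v by rewrite ltr_wpDr ?mulr_gt0.
by rewrite !gt_eqF.
Qed.

Lemma angle_le (y t : R) : 0 <= y <= 1 -> 0 <= t < pi / 2 ->
  (angle (1 - y, y) <= t) = (y <= sin t / (sin t + cos t)).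
Proof.
move=> /andP[y0 y1] /andP[t0 t1]; have pi0 := pi_gt0 R.
have s0 : 0 <= sin t by apply: sin_ge0_pi; rewrite t0 /=; lra.
have c0 : 0 < cos t by apply: cos_gt0_pihalf; apply/andP; split; lra.
have sc0 : 0 < sin t + cos t by rewrite ltr_wpDl.
rewrite ler_pdivlMr// /angle /= subr_eq0 eq_sym; case: eqVneq => [->|yn1].
  by rewrite mul1r leNgt t1; symmetry; apply/negbTE; rewrite -ltNge ltrDl.
have y1' : 0 < 1 - y by rewrite subr_gt0 lt_neqAle yn1.
have -> : (y * (sin t + cos t) <= sin t) = (y / (1 - y) <= tan t).
  by rewrite /tan ler_pdivrMr// mulrAC ler_pdivlMr//; apply/idP/idP; lra.
rewrite -[X in _ <= X]tanK; last by rewrite in_itv /=; apply/andP; split; lra.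
by rewrite (le_mono (@lt_atan R)).
Qed.

End LimitingLaw.

Section InterfaceLimit.
Context {R : realType} {d : measure_display} {T : measurableType d}.
Variables (P : probability T R) (q : R) (omega : lattice -> {RV P >-> nat}).
Hypotheses (hq : 0 < q < 1) (hindep : mutually_independent omega)
  (hgeom : forall (x : lattice) (k : nat), (1 <= k)%N ->
     P [set w | (k <= omega x w)%N] = (q ^+ (k - 1))%:E).
Variables (b : bool) (phi : T -> nat -> R * R).
Hypothesis hphi : forall w,
  InterfaceFacts.explicit_interface (fun x => (omega x w)%:R) b (phi w).

Let X w i j := (omega (i%:Z, j%:Z) w).-1.

Lemma measurable_corner n (A : set {ffun 'I_n * 'I_n -> nat}) :
  measurable [set w | A [ffun x : 'I_n * 'I_n => omega (x.1%:Z, x.2%:Z) w]].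
Proof.
pose atom (v : {ffun 'I_n * 'I_n -> nat}) :=
  \bigcap_(x : 'I_n * 'I_n) (omega (x.1%:Z, x.2%:Z) @^-1` [set v x]).
have -> : [set w | A [ffun x : 'I_n * 'I_n => omega (x.1%:Z, x.2%:Z) w]] =
    \bigcup_v (if v \in A then atom v else set0).
  apply/seteqP; split=> w /=.
    move=> Aw; exists [ffun x : 'I_n * 'I_n => omega (x.1%:Z, x.2%:Z) w] => //.
    by rewrite mem_set// => x _ /=; rewrite ffunE.
  move=> [v _]; case: ifPn => // /set_mem Av vw.
  rewrite (_ : [ffun x => _] = v)//; apply/ffunP => x.
  by rewrite ffunE; exact: vw.
apply: countable_bigcupT_measurable; first exact: countableP.
move=> v; case: ifP => // _; apply: fin_bigcap_measurable; first exact: finite_finset.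
by move=> x _; apply: measurable_omega.
Qed.

Lemma fraction_corner n w w' :
  (forall i j, (i <= n.+1)%N -> (j <= n.+1)%N ->
    omega (i%:Z, j%:Z) w = omega (i%:Z, j%:Z) w') -> phi w n = phi w' n.
Proof.
move=> E; apply: (eq_explicit_interface (hphi w) (hphi w')) => i ni.
exact: (@eq_PD _ _ _ (fun i j => omega (i%:Z, j%:Z) w) (fun i j => omega (i%:Z, j%:Z) w')).
Qed.

Lemma measurable_fraction n : measurable_fun setT (fun w => fraction (phi w) n).
Proof.
move=> _ B _; rewrite setTI.
pose box w : {ffun 'I_n.+2 * 'I_n.+2 -> nat} :=
  [ffun x : 'I_n.+2 * 'I_n.+2 => omega (x.1%:Z, x.2%:Z) w].
rewrite (_ : _ @^-1` B =
  [set w | [set v | exists2 w', box w' = v & B (fraction (phi w') n)] (box w)]).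
  exact: measurable_corner.
apply/seteqP; split=> w /=; first by exists w.
move=> [w' E]; rewrite /fraction (_ : phi w' n = phi w n)//.
apply: fraction_corner => i j ni nj.
have := congr1 (fun v : {ffun _ -> nat} => v (inord i, inord j)) E.
by rewrite !ffunE /= !inordK.
Qed.

Let zero := [set w | exists i j : nat, omega (i%:Z, j%:Z) w = 0%N].

Let zero_null : measurable zero /\ P zero = 0%E.
Proof.
have E : zero = \bigcup_(i : nat) \bigcup_(j : nat) (omega (i%:Z, j%:Z) @^-1` [set 0%N]).
  apply/seteqP; split=> w; first by move=> [i [j h]]; exists i => //; exists j.
  by move=> [i _ [j _ h]]; exists i, j.
have m : measurable zero.
  by rewrite E; apply: bigcupT_measurable => i; apply: bigcupT_measurable => j;
    apply: measurable_omega.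
split=> //; suff : P.-negligible zero by move=> h; apply/negligibleP.
rewrite E; apply: negligible_bigcup => i; apply: negligible_bigcup => j.
apply/negligibleP; first exact: measurable_omega.
have -> : omega (i%:Z, j%:Z) @^-1` [set 0%N] =
    ~` [set w | (1 <= omega (i%:Z, j%:Z) w)%N].
  by apply/seteqP; split=> w /=; [move=> ->|move/negP; rewrite -eqn0Ngt => /eqP].
have m1 : measurable [set w | (1 <= omega (i%:Z, j%:Z) w)%N].
  exact: (measurable_omega _ _ [set k | (1 <= k)%N]).
have : P (~` [set w | (1 <= omega (i%:Z, j%:Z) w)%N]) = 0%E.
  by rewrite probability_setC// hgeom// subnn expr0 subee.
exact.
Qed.

Let omegaX w i j : ~ zero w -> (omega (i%:Z, j%:Z) w)%:R = (X w i j).+1%:R :> R.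
Proof.
move=> nz; rewrite /X prednK// lt0n; apply/eqP => h; apply: nz; by exists i, j.
Qed.

Let array_X : geometric_array P q X.
Proof. exact: geometric_array_omega. Qed.

Let prob_off_zero (A E : set T) (e : R) : measurable A -> measurable E ->
  A `<=` E `|` zero -> (P E <= e%:E)%E -> (P A <= e%:E)%E.
Proof.
move=> mA mE AE PE; have [mz pz] := zero_null.
apply: le_trans PE; rewrite -[leRHS]adde0 -pz.
apply: le_trans (measureU2 _ mE mz).
by apply: le_measure; rewrite ?inE//; apply: measurableU.
Qed.

(** The share y of the vertical coordinate satisfies the hypotheses of
    [cvg_of_tail_bounds], and the direction of the interface is (1 - y, y). *)
Lemma interface_limit : exists xi : {RV P >-> (R * R)%type},
  {ae P, forall w, (fun n : nat =>
     (n%:R^-1 * (phi w n).1, n%:R^-1 * (phi w n).2)) @ \oo --> xi w} /\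
  forall t : R, 0 <= t <= pi / 2 ->
    P [set w | angle (xi w) <= t] =
    (Num.sqrt (q * sin t) /
      ((if b then q else 1) * Num.sqrt (cos t) + Num.sqrt (q * sin t)))%:E.
Proof.
pose y n w := fraction (phi w) n.
have my n : measurable_fun setT (y n) by apply: measurable_fraction.
have y01 n w : 0 < y n w < 1 by apply: fraction_gt0_lt1 (hphi w).
have m_le N f : measurable [set w | exists2 n, (N <= n)%N & y n w <= f].
  rewrite (_ : [set w | _] = \bigcup_(n in [set n | (N <= n)%N]) (y n @^-1` `]-oo, f])).
    by apply: bigcup_measurable => n _; rewrite -[X in measurable X]setTI; apply: my.
  by apply/seteqP; split=> w [n Nn h]; exists n => //; move: h; rewrite /= in_itv.
have m_ge N f : measurable [set w | exists2 n, (N <= n)%N & f <= y n w].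
  rewrite (_ : [set w | _] = \bigcup_(n in [set n | (N <= n)%N]) (y n @^-1` `[f, +oo[)).
    by apply: bigcup_measurable => n _; rewrite -[X in measurable X]setTI; apply: my.
  by apply/seteqP; split=> w [n Nn h]; exists n => //; move: h; rewrite /= in_itv/= andbT.
have [||||||Y [Y01 cY PY]] := @cvg_of_tail_bounds _ _ _ P y (limit_cdf q (~~ b)).
- exact: my.
- exact: y01.
- move=> f eps hf eps0; have e2 : 0 < eps / 2 by rewrite divr_gt0.
  have [a [s [/andP[qa a1] s0 fs slope bound]]] := limit_cdf_approx hq (~~ b) hf e2.
  have q0a : 0 < q < a by case/andP: hq => ->.
  have [K0 [mE PE]] := prob_far_lead (~~ b) array_X q0a a1 s0 slope e2.
  have [N HN] := sector_threshold K0 hf fs.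
  exists N; apply: (prob_off_zero _ mE) => //.
    move=> w [n Nn h]; have [zw|nz] := pselect (zero w); [by right|left].
    exact: (far_lead_of_fraction_le (fun i j => omegaX i j nz) (hphi w) HN Nn h).
  by apply: le_trans PE _; rewrite lee_fin; lra.
- move=> f eps hf eps0; have e2 : 0 < eps / 2 by rewrite divr_gt0.
  have hf' : 0 < 1 - f < 1 by case/andP: hf => ? ?; apply/andP; split; lra.
  have [a [s [/andP[qa a1] s0 fs slope bound]]] := limit_cdf_approx hq b hf' e2.
  have q0a : 0 < q < a by case/andP: hq => ->.
  have [K0 [mE PE]] := prob_far_lead b (geometric_array_tr hq array_X) q0a a1 s0 slope e2.
  have [N HN] := sector_threshold K0 hf' fs.
  exists N; apply: (prob_off_zero _ mE) => //.
    move=> w [n Nn h]; have [zw|nz] := pselect (zero w); [by right|left].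
    exact: (far_lead_of_fraction_ge (fun i j => omegaX i j nz) (hphi w) HN Nn h).
  apply: le_trans PE _; rewrite lee_fin.
  by move: bound; have := limit_cdf_dual hq (~~ b) hf; rewrite negbK => ->; lra.
- by move=> f; apply: continuous_limit_cdf.
- exact: limit_cdf0.
have mxi : measurable_fun setT (fun w => (1 - Y w, Y w)).
  apply: measurable_fun_pair; last exact: measurable_funP.
  by apply: measurable_realfun.measurable_funB => //; exact: measurable_funP.
exists (HB.pack_for {RV P >-> (R * R)%type} (fun w => (1 - Y w, Y w))
  (isMeasurableFun.Build _ _ _ _ _ mxi)).
have ratio : (fun n : nat => n%:R^-1 * n.+1%:R : R) @ \oo --> (1 : R).
  rewrite -(cvg_shiftS (fun n : nat => n%:R^-1 * n.+1%:R : R)).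
  rewrite (_ : (fun n : nat => _) = (cst 1 : R^nat) \+ harmonic).
    have h : (cst 1 : R^nat) \+ harmonic @ \oo --> (1 + 0 : R).
      by apply: cvgD; [exact: cvg_cst|exact: cvg_harmonic].
    by rewrite addr0 in h.
  apply/funext => n; rewrite /harmonic /=.
  by rewrite -[n.+2%:R]natr1 mulrDr mulVf ?pnatr_eq0// mulr1.
split=> /=.
  apply: filterS cY => w cw; have c2 : (fun n => n%:R^-1 * (phi w n).2) @ \oo --> Y w.
    rewrite (_ : (fun n => _) = (fun n : nat => n%:R^-1 * n.+1%:R : R) \* (y ^~ w)).
      by rewrite -[Y w]mul1r; apply: cvgM.
    apply/funext => n; rewrite /y /fraction /= -mulrA; congr (_ * _).
    by rewrite mulrC divfK// pnatr_eq0.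
  suff c1 : (fun n => n%:R^-1 * (phi w n).1) @ \oo --> (1 - Y w).
    exact: (cvg_pair c1 c2).
  rewrite (_ : (fun n => _) = (fun n : nat => n%:R^-1 * n.+1%:R : R) \-
     (fun n : nat => n%:R^-1 * (phi w n).2)); first exact: cvgB.
  by apply/funext => n /=; rewrite (explicit_interface_sum n (hphi w)) mulrBr.
move=> t /andP[t0]; rewrite le_eqVlt => /orP[/eqP ->|t1].
  rewrite sin_pihalf cos_pihalf sqrtr0 mulr0 add0r divff; last first.
    by rewrite gt_eqF// sqrtr_gt0 mulr1; case/andP: hq.
  rewrite (_ : [set w | _] = setT) ?probability_setT// -subTset => w _ /=.
  by rewrite /angle; case: ifP => // _; apply/ltW/atan_ltpi2.
have ht : 0 <= t < pi / 2 by rewrite t0.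
have [hf E] := limit_cdf_angle hq (~~ b) ht.
rewrite if_neg in E; rewrite -E -(PY _ hf); congr (P _).
by apply/seteqP; split=> w /=; rewrite angle_le.
Qed.

End InterfaceLimit.

(** * The theorem *)

Theorem mainTheorem6 (R : realType) (d : measure_display) (T : measurableType d)
    (P : probability T R) (m0 p0 : R) (hm0 : 1 < m0) (hp0 : p0 = m0^-1)
    (omega : lattice -> {RV P >-> nat})
    (hindep : mutually_independent omega)
    (hgeom : forall (x : lattice) (k : nat), (1 <= k)%N ->
       P [set w | (k <= omega x w)%N] = ((1 - p0) ^+ (k - 1))%:E)
    (phi_l phi_r : T -> nat -> R * R)
    (hphi_l : forall w, competition_interface
       (leftmost_geodesic (fun x => (omega x w)%:R : R)) (phi_l w))
    (hphi_r : forall w, competition_interface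
       (rightmost_geodesic (fun x => (omega x w)%:R : R)) (phi_r w)) :
  exists xi_l xi_r : {RV P >-> (R * R)%type},
    [/\ {ae P, forall w, (fun n : nat =>
           (n%:R^-1 * (phi_l w n).1, n%:R^-1 * (phi_l w n).2)) @ \oo --> xi_l w},
        {ae P, forall w, (fun n : nat =>
           (n%:R^-1 * (phi_r w n).1, n%:R^-1 * (phi_r w n).2)) @ \oo --> xi_r w},
        (forall t : R, 0 <= t <= pi / 2 ->
           P [set w | angle (xi_r w) <= t] =
           (Num.sqrt ((1 - p0) * sin t) /
             (Num.sqrt ((1 - p0) * sin t) + Num.sqrt (cos t)))%:E) &
        (forall t : R, 0 <= t <= pi / 2 ->
           P [set w | angle (xi_l w) <= t] =
           (Num.sqrt (sin t) /
             (Num.sqrt (sin t) + Num.sqrt ((1 - p0) * cos t)))%:E)].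
Proof.
have p0_gt0 : 0 < p0 by rewrite hp0 invr_gt0 (lt_trans ltr01).
have p0_lt1 : p0 < 1 by rewrite hp0 invf_lt1 ?(lt_trans ltr01).
have hq : 0 < 1 - p0 < 1 by apply/andP; split; lra.
have explicit_l w : InterfaceFacts.explicit_interface
    (fun x => (omega x w)%:R) true (phi_l w).
  exact: (InterfaceFacts.interfaceP (fun x => (omega x w)%:R) true _).1 (hphi_l w).
have explicit_r w : InterfaceFacts.explicit_interface
    (fun x => (omega x w)%:R) false (phi_r w).
  exact: (InterfaceFacts.interfaceP (fun x => (omega x w)%:R) false _).1 (hphi_r w).
have [xi_l [cvg_l law_l]] := interface_limit hq hindep hgeom explicit_l.
have [xi_r [cvg_r law_r]] := interface_limit hq hindep hgeom explicit_r.
exists xi_l, xi_r; split=> // t ht; first by rewrite law_r// mul1r [Num.sqrt (cos t) + _]addrC.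
rewrite law_l//; congr (_%:E).
have q0 : 0 < 1 - p0 by case/andP: hq.
have r0 : 0 < Num.sqrt (1 - p0) by rewrite sqrtr_gt0.
rewrite !sqrtrM ?(ltW q0)//.
have : 1 - p0 = Num.sqrt (1 - p0) ^+ 2 by rewrite sqr_sqrtr ?ltW.
move: (Num.sqrt (1 - p0)) (Num.sqrt (cos t)) (Num.sqrt (sin t)) r0 => r u v r0 ->.
rewrite (_ : r ^+ 2 * u + r * v = r * (v + r * u)); last by ring.
by rewrite -mulf_div divff ?gt_eqF// mul1r.
Qed.
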